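(* Let $M=\mathrm{Inv}\langle A\mid\mathcal{R}\rangle$ be a finitely presented inverse monoid, and let $w\in\widetilde{A}^*$ be a word. Then the Schützenberger graph of $w$ is tree-like (that is, quasi-isometric to a tree) if and only if the language accepted by the Schützenberger automaton of $w$ is a context-free language.
   Context: $A$ is a finite set, $\widetilde{A}=A\cup A^{-1}$ with $A^{-1}$ a disjoint set of formal inverses, and $\widetilde{A}^*$ is the free monoid on $\widetilde{A}$ with its usual involution. $\mathrm{Inv}\langle A\mid\mathcal{R}\rangle$ denotes the inverse monoid generated by $A$ subject to the relations $\mathcal{R}$ (a finite set of pairs of words over $\widetilde{A}$); every word over $\widetilde{A}$ represents an element of $M$. The Schützenberger graph of $w$ (with respect to the presentation) is the $\widetilde{A}$-labeled directed graph whose vertices are the elements of the $\mathcal{R}$-class (Green's relation) in $M$ of the element represented by $w$, with an edge $s\to sa$ labeled $a\in\widetilde{A}$ whenever $s$ and $sa$ both lie in this $\mathcal{R}$-class. It is a connected deterministic graph in which every edge $s\to sa$ labeled $a$ has an inverse edge $sa\to s$ labeled $a^{-1}$. The Schützenberger automaton of $w$ is this graph with initial vertex $ww^{-1}$ and unique final vertex $w$; the language it accepts is the set of labels of walks from the initial to the final vertex. The graph is regarded as a metric space via the path distance on vertices. A quasi-isometry between metric spaces $(X_1,d_1),(X_2,d_2)$ is a map $\psi:X_1\to X_2$ with positive constants $k,K,c,C,N$ such that $k\,d_1(x,y)-c\le d_2(\psi(x),\psi(y))\le K\,d_1(x,y)+C$ for all $x,y\in X_1$ and every $z\in X_2$ is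 within distance $N$ of some $\psi(x)$. *)

(* Defs.v *)
From HB Require Import structures.
From mathcomp Require Import all_boot all_order all_algebra generic_quotient.
From mathcomp Require Import boolp classical_sets reals.

Set Implicit Arguments.
Unset Strict Implicit.
Unset Printing Implicit Defensive.

Import Order.TTheory GRing.Theory Num.Theory.

Local Open Scope classical_set_scope.

(* The disjoint union of A and its formal inverses: inl a is a, inr a is the
   formal inverse of a. *)
Notation letter A := (A + A)%type.
Notation word A := (seq (letter A)).

Definition linv (A : Type) (x : letter A) : letter A :=
  match x with inl a => inr a | inr a => inl a end.

Definition winv (A : Type) (u : word A) : word A := rev (map (@linv A) u).

Lemma linvK (A : Type) : involutive (@linv A).
Proof. by case. Qed.

Lemma winvK (A : Type) : involutive (@winv A).
Proof.
by move=> u; rewrite /winv map_rev revK (mapK (@linvK A)).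
Qed.

(* The congruence on the free monoid with involution generated by the Vagner
   congruence (whose quotient is the free inverse monoid on A) and rels. *)
Inductive inv_cong (A : finType) (rels : seq (word A * word A)) :
    word A -> word A -> Prop :=
| ic_refl u : inv_cong rels u u
| ic_sym u v : inv_cong rels u v -> inv_cong rels v u
| ic_trans u v t : inv_cong rels u v -> inv_cong rels v t -> inv_cong rels u t
| ic_cat u u' v v' : inv_cong rels u u' -> inv_cong rels v v' ->
    inv_cong rels (u ++ v) (u' ++ v')
| ic_regular u : inv_cong rels (u ++ winv u ++ u) u
| ic_commute u v :
    inv_cong rels (u ++ winv u ++ v ++ winv v) (v ++ winv v ++ u ++ winv u)
| ic_rel u v : (u, v) \in rels -> inv_cong rels u v.

Section InverseMonoidPresentation.
Variables (A : finType) (rels : seq (word A * word A)).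

Definition inv_congb : rel (word A) := fun u v => `[< inv_cong rels u v >].

Lemma inv_congb_refl : reflexive inv_congb.
Proof. by move=> u; apply/asboolP/ic_refl. Qed.

Lemma inv_congb_sym : symmetric inv_congb.
Proof. by move=> u v; apply/asboolP/asboolP; apply: ic_sym. Qed.

Lemma inv_congb_trans : transitive inv_congb.
Proof.
by move=> v u t /asboolP uv /asboolP vt; apply/asboolP/(ic_trans uv vt).
Qed.

Canonical inv_cong_equiv :=
  EquivRel inv_congb inv_congb_refl inv_congb_sym inv_congb_trans.

Definition Inv : Type := {eq_quot inv_congb}%qT.
HB.instance Definition _ := Choice.on Inv.
HB.instance Definition _ := EqQuotient.on Inv.

Definition InvElt (u : word A) : Inv := \pi_Inv%qT u.

Lemma InvEltP u v : InvElt u = InvElt v <-> inv_cong rels u v.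
Proof.
by split=> [/eqmodP/asboolP // | uv]; apply/eqmodP/asboolP.
Qed.

Lemma InvElt_surj (x : Inv) : exists u, x = InvElt u.
Proof. by exists (repr x); rewrite /InvElt reprK. Qed.

Definition Inv_mul (x y : Inv) : Inv := InvElt (repr x ++ repr y).
Definition Inv_one : Inv := InvElt [::].

Lemma Inv_mulE u v : Inv_mul (InvElt u) (InvElt v) = InvElt (u ++ v).
Proof. by apply/InvEltP/ic_cat; apply/InvEltP; rewrite /InvElt reprK. Qed.

Lemma Inv_mulA : associative Inv_mul.
Proof.
move=> x y z; case: (InvElt_surj x) (InvElt_surj y) (InvElt_surj z).
by move=> u -> [v ->] [t ->]; rewrite !Inv_mulE catA.
Qed.

Lemma Inv_mul1 : left_id Inv_one Inv_mul.
Proof. by move=> x; case: (InvElt_surj x) => u ->; rewrite Inv_mulE. Qed.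

Lemma Inv_mulr1 : right_id Inv_one Inv_mul.
Proof.
by move=> x; case: (InvElt_surj x) => u ->; rewrite Inv_mulE cats0.
Qed.

HB.instance Definition _ :=
  isMonoid.Build Inv Inv_mulA Inv_mul1 Inv_mulr1.

Lemma InvEltM u v : InvElt (u ++ v) = (InvElt u * InvElt v)%g.
Proof. by rewrite -Inv_mulE. Qed.

Lemma InvElt_reg u : (InvElt u * InvElt (winv u) * InvElt u)%g = InvElt u.
Proof. by rewrite -!InvEltM -catA; apply/InvEltP/ic_regular. Qed.

Lemma InvElt_comm u v :
  (InvElt u * InvElt (winv u) * (InvElt v * InvElt (winv v)) =
   InvElt v * InvElt (winv v) * (InvElt u * InvElt (winv u)))%g.
Proof. by rewrite -!InvEltM -!catA; apply/InvEltP/ic_commute. Qed.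

Lemma InvElt_idem u : (InvElt u * InvElt u = InvElt u)%g ->
  InvElt u = (InvElt u * InvElt (winv u))%g.
Proof.
move=> ee; have := InvElt_reg u; have := InvElt_reg (winv u).
have := InvElt_comm u (winv u); rewrite winvK.
move: (InvElt u) (InvElt (winv u)) ee => e f ee comm fef efe.
have effe : (f = e * f * (f * e))%g.
  by rewrite comm -mulgA (mulgA e) ee mulgA fef.
have ef : (e * f = f)%g by rewrite effe !mulgA ee.
have fe : (f * e = f)%g by rewrite effe -!mulgA ee.
by rewrite ef -[LHS]efe ef fe.
Qed.

Lemma Inv_inverse (x : Inv) :
  exists! y : Inv, (x * y * x = x)%g /\ (y * x * y = y)%g.
Proof.
have [u ux] := InvElt_surj x.
have idemE (a : Inv) : (a * a = a)%g ->
    exists v, a = (InvElt v * InvElt (winv v))%g.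
  by have [v ->] := InvElt_surj a => /InvElt_idem vE; exists v.
have idemC (a b : Inv) : (a * a = a)%g -> (b * b = b)%g -> (a * b = b * a)%g.
  by move=> /idemE[v ->] /idemE[t ->]; apply: InvElt_comm.
exists (InvElt (winv u)); split.
  by split; rewrite ux ?InvElt_reg // -{2}(winvK u) InvElt_reg.
move: (InvElt (winv u)) (InvElt_reg u) (InvElt_reg (winv u)).
rewrite winvK -ux => y xyx yxy z [xzx zxz].
have idl (a : Inv) : (x * a * x = x -> (a * x) * (a * x) = a * x)%g.
  by move=> h; rewrite -mulgA (mulgA x) h.
have idr (a : Inv) : (x * a * x = x -> (x * a) * (x * a) = x * a)%g.
  by move=> h; rewrite mulgA h.
transitivity (z * x * y)%g.
  have c := idemC _ _ (idl _ xyx) (idl _ xzx).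
  have : (y * x * (z * x) * y = y)%g by rewrite -(mulgA y) (mulgA x) xzx.
  by rewrite c -!mulgA (mulgA y) yxy => {1}<-.
have c := idemC _ _ (idr _ xyx) (idr _ xzx).
have : (z * (x * y * (x * z)) = z)%g by rewrite (mulgA (x * y)%g) xyx mulgA.
by rewrite c !mulgA zxz => {2}<-.
Qed.

End InverseMonoidPresentation.

(* Green's relation R: s and t generate the same right ideal. *)
Definition Rclass (M : monoidType) (s : M) : set M :=
  [set t | range (fun x => s * x)%g = range (fun x => t * x)%g].

(* V is the vertex set of a graph with edges labelled in L. *)
Section LabelledGraph.
Variables (L : finType) (V : eqType) (edge : V -> L -> V -> bool).

Fixpoint walk (s : V) (u : seq L) (t : V) : Prop :=
  if u is a :: u' then exists2 r, edge s a r & walk r u' t else s = t.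

Definition accepted (init final : V) : set (seq L) :=
  [set u | walk init u final].

Definition adj : rel V := fun s t => [exists a, edge s a t].

End LabelledGraph.

Section Schutzenberger.
Variables (A : finType) (rels : seq (word A * word A)) (w : word A).

Definition sch_vertex : choiceType := Rclass (InvElt rels w).

Definition sch_elt (s : sch_vertex) : Inv rels := val s.

Definition sch_edge (s : sch_vertex) (a : letter A) (t : sch_vertex) : bool :=
  sch_elt t == (sch_elt s * InvElt rels [:: a])%g.

Lemma sch_init_subproof : InvElt rels (w ++ winv w) \in Rclass (InvElt rels w).
Proof.
rewrite inE /Rclass /=; apply/seteqP; split=> _ [x _ <-].
  exists (InvElt rels w * x)%g => //.
  by rewrite InvEltM mulgA InvElt_reg.
by exists (InvElt rels (winv w) * x)%g => //; rewrite InvEltM mulgA.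
Qed.

Lemma sch_final_subproof : InvElt rels w \in Rclass (InvElt rels w).
Proof. by rewrite inE. Qed.

Definition sch_init : sch_vertex :=
  exist (fun s => s \in Rclass (InvElt rels w)) _ sch_init_subproof.
Definition sch_final : sch_vertex :=
  exist (fun s => s \in Rclass (InvElt rels w)) _ sch_final_subproof.

Definition sch_language : set (word A) := accepted sch_edge sch_init sch_final.

Lemma sch_elt_inj : injective sch_elt.
Proof. exact: val_inj. Qed.

Lemma sch_eltP (s t : sch_vertex) :
  range (fun x => sch_elt s * x)%g = range (fun x => sch_elt t * x)%g.
Proof.
have sP : Rclass (InvElt rels w) (sch_elt s) by rewrite -in_setE; apply: valP.
have tP : Rclass (InvElt rels w) (sch_elt t) by rewrite -in_setE; apply: valP.
exact: etrans (esym sP) tP.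
Qed.

Lemma sch_elt_onto (x : Inv rels) (s : sch_vertex) :
  range (fun y => sch_elt s * y)%g = range (fun y => x * y)%g ->
  exists t, sch_elt t = x.
Proof.
move=> sx; have xP : x \in Rclass (InvElt rels w).
  by rewrite in_setE; apply: etrans sx; apply: (sch_eltP sch_final s).
by exists (exist (fun s => s \in Rclass (InvElt rels w)) x xP).
Qed.

Lemma sch_connect (s t : sch_vertex) : exists x, sch_elt t = (sch_elt s * x)%g.
Proof.
have : range (fun x => sch_elt t * x)%g (sch_elt t).
  by exists 1%g; rewrite ?mulg1.
by rewrite -(sch_eltP s t) => -[x _ xE]; exists x; rewrite xE.
Qed.

Lemma sch_walkP (s : sch_vertex) (u : word A) (t : sch_vertex) :
  walk sch_edge s u t <-> sch_elt t = (sch_elt s * InvElt rels u)%g.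
Proof.
elim: u s => [|a u IHu] s /=.
  by rewrite mulg1; split=> [-> // | ts]; apply: sch_elt_inj.
split=> [[r /eqP rE /IHu ->]|tE].
  by rewrite rE -mulgA -InvEltM.
have tE' : sch_elt t = (sch_elt s * InvElt rels [:: a] * InvElt rels u)%g.
  by rewrite tE -mulgA -InvEltM.
have [|r rE] := @sch_elt_onto (sch_elt s * InvElt rels [:: a])%g s.
  apply/seteqP; split.
    rewrite (sch_eltP s t) => _ [x _ <-].
    by exists (InvElt rels u * x)%g; rewrite // mulgA -tE'.
  by move=> _ [x _ <-]; exists (InvElt rels [:: a] * x)%g; rewrite // mulgA.
by exists r; [apply/eqP | apply/IHu; rewrite rE].
Qed.

Lemma sch_edge_inv (s : sch_vertex) a (t : sch_vertex) :
  sch_edge s a t -> sch_edge t (linv a) s.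
Proof.
rewrite /sch_edge => /eqP tE; rewrite tE -mulgA.
have [x] := sch_connect t s; rewrite tE.
have [v vE] := InvElt_surj (sch_elt s).
have := InvElt_comm rels [:: a] (winv v); rewrite winvK.
have := InvElt_reg rels [:: a]; have := InvElt_reg rels v.
have -> : winv [:: a] = [:: linv a] by [].
rewrite -vE; move: (sch_elt s) (InvElt rels (winv v)).
move: (InvElt rels [:: a]) (InvElt rels [:: linv a]) => b b' e e' ereg breg c ex.
have eE : (e' * e = e' * e * (b * x))%g by rewrite {1}ex !mulgA.
have bE : (b * b' * (e' * e) = e' * e)%g.
  rewrite {1}eE mulgA c -(mulgA (e' * e)%g) (mulgA (b * b')%g) breg.
  by rewrite -eE.
apply/eqP/esym.
by rewrite -{1}ereg -(mulgA e e' e) -(mulgA e) -c bE mulgA ereg.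
Qed.

Lemma sch_connected (s t : sch_vertex) : exists u, walk sch_edge s u t.
Proof.
have [x xE] := sch_connect s t; have [u uE] := InvElt_surj x.
by exists u; apply/sch_walkP; rewrite xE uE.
Qed.

End Schutzenberger.

(* The length of a shortest path; 0 by convention if there is none, which does
   not occur in trees and in Schutzenberger graphs, as these are connected. *)
Definition gdist (T : eqType) (e : rel T) (x y : T) : nat :=
  let P n := `[< exists2 p, path e x p & last x p = y /\ size p = n >] in
  if pselect (exists n, P n) is left exP then ex_minn exP else 0.

(* A simple graph, possibly infinite and not necessarily locally finite, that
   is connected and has no cycle of length at least 3. *)
Definition is_tree (T : eqType) (e : rel T) : Prop :=
  [/\ symmetric e, irreflexive e,
      forall x y, exists2 p, path e x p & last x p = y
    & forall c, ucycle e c -> size c <= 2].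

(* d1 and d2 are meant to be metrics; they are graph distances below. *)
Definition quasi_isometry (R : realType) (X1 X2 : Type)
    (d1 : X1 -> X1 -> R) (d2 : X2 -> X2 -> R) (psi : X1 -> X2) : Prop :=
  exists k K c C N : R,
    [/\ [/\ 0 < k, 0 < K, 0 < c, 0 < C & 0 < N],
        forall x y, k * d1 x y - c <= d2 (psi x) (psi y) <= K * d1 x y + C
      & forall z, exists x, d2 z (psi x) <= N]%R.

Definition quasi_isometric (R : realType) (X1 X2 : Type)
    (d1 : X1 -> X1 -> R) (d2 : X2 -> X2 -> R) : Prop :=
  exists psi : X1 -> X2, quasi_isometry d1 d2 psi.

Definition tree_like (R : realType) (V : eqType) (e : rel V) : Prop :=
  exists (T : eqType) (f : rel T), is_tree f /\
    quasi_isometric (fun x y => (gdist e x y)%:R : R)%R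
                    (fun x y => (gdist f x y)%:R : R)%R.

Record cfg (L : finType) := CFG {
  nonterminal : finType;
  start : nonterminal;
  productions : seq (nonterminal * seq (nonterminal + L)) }.

Inductive derives (L : finType) (G : cfg L) :
    seq (nonterminal G + L) -> seq (nonterminal G + L) -> Prop :=
| derives_refl s : derives s s
| derives_step s l X b r : (X, b) \in productions G ->
    derives s (l ++ inl X :: r) -> derives s (l ++ b ++ r).

Definition cfg_language (L : finType) (G : cfg L) : set (seq L) :=
  [set u | derives [:: inl (start G)] (map inr u)].

Definition context_free (L : finType) (K : set (seq L)) : Prop :=
  exists G : cfg L, cfg_language G = K.

(* Main.v *)
Require Import Defs.
From HB Require Import structures.
From mathcomp Require Import all_boot all_order all_algebra generic_quotient.
From mathcomp Require Import boolp classical_sets reals.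
From mathcomp Require Import zify.

(** A thin triangle condition links both sides: for every closed walk
    [x0 -> x -> y -> x0] some point of the middle side is uniformly close to
    points of the other two sides.  It holds when the language is context-free
    (cut a derivation tree at the smallest node whose yield contains the middle
    side) and when the graph is quasi-isometric to a tree (the three sides of a
    closed walk in a tree share a vertex).

    Let [h] be the distance to the vertices of the walk [w].  A cone is a
    component of [{h >= n}], its frontier is its part at height [n].  Thin
    triangles bound the diameters of all frontiers.  Hence the cones form a tree
    quasi-isometric to the graph.

    Hence also the language is context-free.  As the Schutzenberger graph maps
    to every deterministic graph that respects the relators and reads [w], a
    cone is forced by a bounded neighbourhood of its frontier: whenever that
    neighbourhood can be read at a vertex [p], any two coterminal walks in the
    cone can be read at [p] and are coterminal there (lemma [cone_transfer]).
    So the neighbourhoods, which have finitely many types, serve as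
    nonterminals of a grammar that follows a walk through the nested cones. *)

Set Implicit Arguments.
Unset Strict Implicit.
Unset Printing Implicit Defensive.

(** * Walks in inverse graphs *)

Section Walks.
Variables (L : finType) (V : eqType) (edge : V -> L -> V -> bool).
Implicit Types (s t r : V) (u v : seq L).

Lemma walk_cat s u v t :
  walk edge s (u ++ v) t <-> exists2 r, walk edge s u r & walk edge r v t.
Proof.
elim: u s => [|a u IHu] s /=; first by split=> [|[r ->]] //; exists s.
split=> [[r sr /IHu[q ru uq]]|[q [r sr ru] qt]].
  by exists q => //; exists r.
by exists r => //; apply/IHu; exists q.
Qed.

Lemma walk_catI s u r v t :
  walk edge s u r -> walk edge r v t -> walk edge s (u ++ v) t.
Proof. by move=> su rv; apply/walk_cat; exists r. Qed.

Lemma walk1 s a t : walk edge s [:: a] t <-> edge s a t.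
Proof. by split=> [[r sr <-]|st] //; exists t. Qed.

Lemma walk_rcons s u r a t :
  walk edge s u r -> edge r a t -> walk edge s (rcons u a) t.
Proof.
by move=> su ra; rewrite -cats1; apply: walk_catI su _; apply/walk1.
Qed.

Definition near k s t := exists2 u, size u <= k & walk edge s u t.

Lemma near0 k s : near k s s. Proof. by exists [::]. Qed.

Lemma near_leq k k' s t : k <= k' -> near k s t -> near k' s t.
Proof. by move=> kk' [u uk su]; exists u => //; apply: leq_trans kk'. Qed.

Lemma near_trans k k' s r t : near k s r -> near k' r t -> near (k + k') s t.
Proof.
move=> [u uk su] [v vk rv]; exists (u ++ v); last exact: walk_catI rv.
by rewrite size_cat leq_add.
Qed.

Lemma near1 s a t : edge s a t -> near 1 s t.
Proof. by move=> st; exists [:: a] => //; apply/walk1. Qed.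

(** Only edges are restricted, so the empty walk at a vertex counts as a walk in [P] even when that
    vertex is outside [P]. *)
Definition edge_in (P : V -> Prop) s a t := [&& edge s a t, `[< P s >] & `[< P t >]].

End Walks.

Notation walk_in edge P := (walk (edge_in edge P)).

Lemma walk_morph (L : finType) (V V' : eqType) (e : V -> L -> V -> bool)
    (e' : V' -> L -> V' -> bool) (phi : V -> V') s u t :
  (forall x a y, e x a y -> e' (phi x) a (phi y)) ->
  walk e s u t -> walk e' (phi s) u (phi t).
Proof.
move=> ee'; elim: u s => [|a u IHu] s /= => [-> //|[r sr ru]].
by exists (phi r); [apply: ee' | apply: IHu].
Qed.

Section Restriction.
Variables (L : finType) (V : eqType) (edge : V -> L -> V -> bool).
Implicit Types (s t r : V) (u v : seq L) (P : V -> Prop).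

Lemma edge_inP P s a t : edge_in edge P s a t <-> [/\ edge s a t, P s & P t].
Proof.
split=> [/and3P[st /asboolP Ps /asboolP Pt] //|[st Ps Pt]].
by apply/and3P; split=> //; apply/asboolP.
Qed.

Lemma walk_sub P s u t : walk_in edge P s u t -> walk edge s u t.
Proof. by apply: (@walk_morph _ _ _ _ _ id) => x a y /edge_inP[]. Qed.

Lemma walk_subset P P' s u t : (forall x, P x -> P' x) ->
  walk_in edge P s u t -> walk_in edge P' s u t.
Proof.
move=> PP'; apply: (@walk_morph _ _ _ _ _ id) => x a y /edge_inP[xy Px Py].
by apply/edge_inP; split=> //; apply: PP'.
Qed.

Lemma walk_in_end P s u t : P s -> walk_in edge P s u t -> P t.
Proof.
by elim: u s => [|a u IHu] s Ps /= => [<- //|[r /edge_inP[_ _ Pr] /IHu]]; apply.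
Qed.

Lemma walk_edge_in P s u t : walk edge s u t ->
  (forall u1 u2 r, u = u1 ++ u2 -> walk edge s u1 r -> P r) ->
  walk_in edge P s u t.
Proof.
elim: u s => [|a u IHu] s //= [r sr ru] uP; exists r.
  apply/edge_inP; split=> //; first exact: (uP [::] (a :: u)).
  by apply: (uP [:: a] u) => //; exists r.
apply: IHu => // u1 u2 q uE rq; apply: (uP (a :: u1) u2); rewrite ?uE //.
by exists r.
Qed.

End Restriction.

Section InverseGraph.
Variables (A : finType) (V : eqType) (edge : V -> letter A -> V -> bool).
Implicit Types (s t r : V) (u v : word A).

Definition deterministic := forall s a t t', edge s a t -> edge s a t' -> t = t'.
Definition invertible := forall s a t, edge s a t -> edge t (linv a) s.
Definition respects (rels : seq (word A * word A)) := forall u v,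
  (u, v) \in rels -> forall s t, walk edge s u t <-> walk edge s v t.

Hypotheses (edge_det : deterministic) (edge_inv : invertible).

Lemma walk_det s u t t' : walk edge s u t -> walk edge s u t' -> t = t'.
Proof.
elim: u s => [|a u IHu] s /= => [-> //|[r sr ru] [r' sr' ru']].
by apply: IHu ru _; rewrite (edge_det sr sr').
Qed.

Lemma winv_cons a u : winv (a :: u) = rcons (winv u) (linv a).
Proof. by rewrite /winv /= rev_cons. Qed.

Lemma winv_cat u v : winv (u ++ v) = winv v ++ winv u.
Proof. by rewrite /winv map_cat rev_cat. Qed.

Lemma size_winv u : size (winv u) = size u.
Proof. by rewrite /winv size_rev size_map. Qed.

Lemma walk_inv s u t : walk edge s u t -> walk edge t (winv u) s.
Proof.
elim: u s => [|a u IHu] s /= => [-> //|[r sr /IHu tr]].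
by rewrite winv_cons; apply: walk_rcons tr (edge_inv sr).
Qed.

Lemma walk_invE s u t : walk edge s (winv u) t <-> walk edge t u s.
Proof. by split=> /walk_inv //; rewrite winvK. Qed.

Lemma walk_codet s s' u t : walk edge s u t -> walk edge s' u t -> s = s'.
Proof. by move=> /walk_inv ts /walk_inv; apply: walk_det. Qed.

Lemma near_sym k s t : near edge k s t -> near edge k t s.
Proof.
by move=> [u uk /walk_inv tu]; exists (winv u); rewrite ?size_winv.
Qed.

(** Words act on the vertices as partial injections, and these form an inverse monoid: [u u^-1 u]
    acts as [u], and idempotents commute because they are restrictions of the identity. *)
Lemma inv_cong_walk rels u v : respects rels -> inv_cong rels u v ->
  forall s t, walk edge s u t <-> walk edge s v t.
Proof.
move=> relsP; elim=> {u v} // [u v _ IH|u v t _ IHu _ IHv|u u' v v' _ IHu _ IHv|u|u v] s t'.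
- by split=> /IH.
- by rewrite IHu IHv.
- by split=> /walk_cat[r /IHu su /IHv rt]; apply/walk_cat; exists r.
- split=> [/walk_cat[r su /walk_cat[q /walk_invE qr qt]]|st].
    by rewrite (walk_codet su qr).
  by apply: (walk_catI st); apply: (walk_catI _ st); apply/walk_invE.
- suff com u' v' : walk edge s (u' ++ winv u' ++ v' ++ winv v') t' ->
      walk edge s (v' ++ winv v' ++ u' ++ winv u') t' by split; apply: com.
  case/walk_cat=> r su /walk_cat[q /walk_invE qr] /walk_cat[x qx /walk_invE tx].
  rewrite -(walk_codet su qr) in qx *; rewrite -(walk_codet qx tx).
  apply: (walk_catI qx); apply: (@walk_catI _ _ _ _ _ s); first exact/walk_invE.
  by apply: (walk_catI su); apply/walk_invE.
Qed.

End InverseGraph.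

Lemma invertible_in (A : finType) (V : eqType)
    (edge : V -> letter A -> V -> bool) P :
  invertible edge -> invertible (edge_in edge P).
Proof.
by move=> inv s a t /edge_inP[/inv ts Ps Pt]; apply/edge_inP.
Qed.

(** * Thin triangles from derivations *)

(** Levi's lemma for the free monoid. *)
Lemma eq_cat_split (T : Type) (a b c d : seq T) : a ++ b = c ++ d ->
  size a <= size c -> exists2 e, c = a ++ e & b = e ++ d.
Proof.
elim: a c => [|x a IHa] [|y c] //=.
- by move=> -> _; exists [::].
- by move=> -> _; exists (y :: c).
- by case=> -> /IHa + /ltnSE => /[apply] -[e -> ->]; exists e.
Qed.

Section ThinTriangles.
Variables (L : finType) (V : eqType) (edge : V -> L -> V -> bool).

Definition on_walk s u t r :=
  exists u1 u2, [/\ u = u1 ++ u2, walk edge s u1 r & walk edge r u2 t].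

Definition thin_triangles x0 k := forall x y u v t,
  walk edge x0 u x -> walk edge x v y -> walk edge y t x0 ->
  exists a b c, [/\ on_walk x0 u x a, on_walk x v y b, on_walk y t x0 c,
                    near edge k a b & near edge k b c].

End ThinTriangles.

Section BigStepDerivations.
Variables (L : finType) (G : cfg L).
Local Notation form := (seq (nonterminal G + L)).
Implicit Types (s l r : form) (u v : seq L).

(** Derivation forests, one tree per symbol of the form. Induction on them gives access to the words
    yielded by the body of each rule, unlike induction on rewriting steps. *)
Inductive yields : form -> seq L -> Prop :=
| yields_nil : yields [::] [::]
| yields_letter a s u : yields s u -> yields (inr a :: s) (a :: u)
| yields_rule X b s u v : (X, b) \in productions G ->
    yields b u -> yields s v -> yields (inl X :: s) (u ++ v).

Lemma yields_letters u : yields (map inr u) u.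
Proof. by elim: u => [|a u IHu]; constructor. Qed.

Lemma yields_cat l r u :
  yields (l ++ r) u <-> exists u1 u2, [/\ u = u1 ++ u2, yields l u1 & yields r u2].
Proof.
split; last first.
  case=> u1 [u2 [-> lu1 ru2]]; elim: lu1 => [|a s v _|X b s v v1 Xb bv _ _] /=.
  - by [].
  - exact: yields_letter.
  - by move=> IH; rewrite -catA; apply: (yields_rule Xb bv IH).
elim: l u => [|x l IHl] u /= ru; first by exists [::], u; split=> //; constructor.
inversion ru as [|a s v sv [xE sE] uE|X b s v1 v2 Xb bv1 sv2 [xE sE] uE].
  have [u1 [u2 [-> lu1 ru2]]] := IHl _ sv.
  by exists (a :: u1), u2; split=> //; constructor.
have [u1 [u2 [-> lu1 ru2]]] := IHl _ sv2.
by exists (v1 ++ u1), u2; split; rewrite ?catA //; apply: (yields_rule Xb bv1 lu1).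
Qed.

Lemma derives_yields s u : derives s (map inr u) <-> yields s u.
Proof.
split=> [st|su].
  have := yields_letters u; elim: st => // {}s l X b r Xb _ IH.
  case/yields_cat=> u1 [u2 [uE lu1 /yields_cat[v1 [v2 [u2E bv1 rv2]]]]].
  rewrite {}u2E in uE; apply: IH; apply/yields_cat; exists u1, (v1 ++ v2); split=> //.
  exact: (yields_rule Xb bv1 rv2).
have ctx l r s1 t1 : derives s1 t1 -> derives (l ++ s1 ++ r) (l ++ t1 ++ r).
  elim=> [s2|s2 l' X b r' Xb _ IH]; first exact: derives_refl.
  have := @derives_step _ G (l ++ s2 ++ r) (l ++ l') X b (r' ++ r) Xb.
  by rewrite -!catA /= in IH *; rewrite !catA in IH *; apply.
have trans s1 s2 s3 : derives s1 s2 -> derives s2 s3 -> derives s1 s3.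
  move=> + s23; elim: s23 => // s4 l' X b r' Xb _ IH s14.
  exact: (derives_step Xb (IH s14)).
elim: su => /= [|a s1 u1 _ IH|X b s1 u1 u2 Xb _ IHb _ IHs].
- exact: derives_refl.
- by have := ctx [:: inr a] [::] _ _ IH; rewrite /= !cats0.
- apply: (trans _ (b ++ s1)).
    by have := @derives_step _ G (inl X :: s1) [::] X b s1 Xb; apply; apply: derives_refl.
  rewrite map_cat; apply: (trans _ (map inr u1 ++ s1)).
    exact: (ctx [::]).
  by have := ctx (map inr u1) [::] _ _ IHs; rewrite !cats0.
Qed.

End BigStepDerivations.

Section ContextFreeToThin.
Variables (A : finType) (V : eqType) (edge : V -> letter A -> V -> bool).
Hypotheses (edge_det : deterministic edge) (edge_inv : invertible edge).
Variables (G : cfg (letter A)) (x0 xf : V).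
Hypothesis langE : cfg_language G = accepted edge x0 xf.
Local Notation walk := (walk edge).
Local Notation near := (near edge).
Local Notation symbol := (nonterminal G + letter A)%type.

(* Determinism makes this property pass from a sentential form to its symbols:
   replacing the yield of one symbol moves no cut point of the walk. *)
Definition carries p (s : seq symbol) q := forall u, yields s u -> walk p u q.

Lemma carries_start : carries x0 [:: inl (start G)] xf.
Proof.
move=> u /derives_yields; rewrite -[derives _ _]/(cfg_language G u) langE.
exact.
Qed.

Lemma carries_rule p X b q : (X, b) \in productions G ->
  carries p [:: inl X] q -> carries p b q.
Proof.
move=> Xb pXq u bu; apply: pXq; rewrite -(cats0 u).
by apply: (yields_rule Xb bu); constructor.
Qed.

Lemma carries_cons p y s q u v : carries p (y :: s) q ->
  yields [:: y] u -> yields s v ->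
  exists m, [/\ walk p u m, walk m v q, carries p [:: y] m & carries m s q].
Proof.
move=> psq yu sv.
have yield u' v' : yields [:: y] u' -> yields s v' -> walk p (u' ++ v') q.
  by move=> yu' sv'; apply: psq; apply/(yields_cat [:: y]); exists u', v'.
have /walk_cat[m pu mv] := yield _ _ yu sv; exists m; split=> // [u' yu'|v' sv'].
  have /walk_cat[m' pu' mv'] := yield _ _ yu' sv.
  by rewrite (walk_codet edge_det edge_inv mv mv').
have /walk_cat[m' pu' mv'] := yield _ _ yu sv'.
by rewrite (walk_det edge_det pu pu').
Qed.

(* Junk value [[::]] if [X] yields no word. *)
Definition some_yield X : word A :=
  if pselect (exists u, yields [:: inl X : symbol] u) is left e
  then projT1 (cid e) else [::].

Lemma some_yieldP X u : yields [:: inl X] u -> yields [:: inl X] (some_yield X).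
Proof.
move=> Xu; rewrite /some_yield; case: pselect => [e|[]]; last by exists u.
by case: cid.
Qed.

(** The successor makes the bound at least 1, so that it also covers letters. *)
Definition symbol_bound := (\max_X size (some_yield X)).+1.
Local Notation k := symbol_bound.

(** All yields of a symbol lead to the same end, so the bounded word [some_yield X] can replace
    each, possibly long, yield of [X]. *)
Lemma carries_near p s q u : carries p s q -> yields s u -> near (k * size s) p q.
Proof.
move=> + su; elim: su p => [|a s' u' su' IH|X b s' u1 u2 Xb bu1 _ su2 IH] p psq.
- by rewrite muln0 -(psq [::] (yields_nil _)); apply: near0.
- have aa : yields [:: inr a : symbol] [:: a] by do 2 constructor.
  have [m [pm mq _ ms]] := carries_cons psq aa su'.
  rewrite mulnS; apply: near_trans (IH _ ms).
  by exists [:: a].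
- have Xu1 : yields [:: inl X] u1.
    by rewrite -(cats0 u1); apply: yields_rule bu1 _ => //; constructor.
  have [m [_ _ pX ms]] := carries_cons psq Xu1 su2.
  rewrite mulnS; apply: near_trans (IH _ ms).
  exists (some_yield X); last exact: pX (some_yieldP Xu1).
  by rewrite leqW // (bigmax_sup X).
Qed.

Definition body_bound := \max_(Xb <- productions G) size Xb.2.

Lemma body_boundP X b : (X, b) \in productions G -> size b <= body_bound.
Proof.
by move=> Xb; rewrite /body_bound; apply: (@leq_bigmax_seq _ _ xpredT (fun x => size x.2) (X, b)).
Qed.

(** Thin triangles for an open walk [u v t]. The three points are named by prefixes read from [p],
    so the condition survives lengthening the walk at either end. *)
Definition thin_at p u v t := exists a b c u1 u2 v1 v2 t1 t2,
  [/\ [/\ u = u1 ++ u2, v = v1 ++ v2 & t = t1 ++ t2],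
      [/\ walk p u1 a, walk p (u ++ v1) b & walk p (u ++ v ++ t1) c]
    & near (k * body_bound) a b /\ near (k * body_bound) b c].

Lemma thin_at_catl p u0 q u v t : walk p u0 q ->
  thin_at q u v t -> thin_at p (u0 ++ u) v t.
Proof.
move=> pq [a [b [c [u1 [u2 [v1 [v2 [t1 [t2 [[-> -> ->] [qa qb qc] abc]]]]]]]]]].
exists a, b, c, (u0 ++ u1), u2, v1, v2, t1, t2; split=> //; first by rewrite catA.
by rewrite -!catA in qb qc *; split; apply: walk_catI pq _.
Qed.

Lemma thin_at_catr p u v t t' : thin_at p u v t -> thin_at p u v (t ++ t').
Proof.
move=> [a [b [c [u1 [u2 [v1 [v2 [t1 [t2 [[-> -> ->] qabc abc]]]]]]]]]].
by exists a, b, c, u1, u2, v1, v2, t1, (t2 ++ t'); rewrite catA.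
Qed.

(* In the second case a cut point of the factorization along [s] falls inside [v]. *)
Lemma yields_thin p s q z u v t : carries p s q -> yields s z -> z = u ++ v ++ t ->
  thin_at p u v t \/
  exists b v1 v2, [/\ v = v1 ++ v2, walk p (u ++ v1) b,
                      near (k * size s) p b & near (k * size s) b q].
Proof.
move=> + sz; elim: sz p q u v t =>
  [|a s' z' sz' IH|X b s' z1 z2 Xb bz1 IHb sz2 IHs] p q u v t psq zE.
- right; exists p, [::], [::]; case: u v t zE => [|? ?] [|? ?] [|? ?] // _.
  by split=> //; rewrite ?muln0 -?(psq [::] (yields_nil _)); apply: near0.
- have aa : yields [:: inr a : symbol] [:: a] by do 2 constructor.
  have sz : yields (inr a :: s') (a :: z') by constructor.
  have [m [pm mq _ ms]] := carries_cons psq aa sz'.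
  case: u zE => [|a' u] zE.
    right; exists p, [::], v; split=> //; first exact: near0.
    exact: carries_near psq sz.
  case: zE pm aa sz => <- z'E pm _ _; rewrite /= mulnS.
  have pm1 : near k p m by exists [:: a].
  have [T|[b [v1 [v2 [-> mb mb' bq]]]]] := IH _ _ _ _ _ ms z'E.
    by left; apply: (thin_at_catl pm T).
  right; exists b, v1, v2; split=> //; first exact: (walk_catI pm mb).
    exact: near_trans mb'.
  by apply: near_leq bq; rewrite leq_addl.
- have Xz1 : yields [:: inl X] z1.
    by rewrite -(cats0 z1); apply: yields_rule bz1 _ => //; constructor.
  have Xsz : yields (inl X :: s') (z1 ++ z2) by apply: (yields_rule Xb bz1 sz2).
  have [m [pm mq pX ms]] := carries_cons psq Xz1 sz2.
  have pmk : near k p m.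
    by have := carries_near pX Xz1; rewrite muln1.
  have mqk := carries_near ms sz2.
  rewrite /= mulnS; case: (leqP (size z1) (size u)) => z1u.
    have [u' uE z2E] := eq_cat_split zE z1u.
    have [T|[c [v1 [v2 [-> mc mc' cq]]]]] := IHs _ _ _ _ _ ms z2E.
      by left; rewrite uE; apply: (thin_at_catl pm T).
    right; exists c, v1, v2; split=> //.
    + by rewrite uE -catA; apply: (walk_catI pm mc).
    + exact: near_trans mc'.
    + by apply: near_leq cq; rewrite leq_addl.
  have [v' z1E vtE] := eq_cat_split (esym zE) (ltnW z1u).
  case: (leqP (size v') (size v)) => v'v.
    have [v2 vE z2E] := eq_cat_split (esym vtE) v'v.
    right; exists m, v', v2; split=> //; first by rewrite -z1E.
      by apply: near_leq pmk; rewrite leq_addr.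
    by apply: near_leq mqk; rewrite leq_addl.
  have [t1 v'E tE] := eq_cat_split vtE (ltnW v'v).
  have pb := carries_rule Xb pX.
  have z1E' : z1 = u ++ v ++ t1 by rewrite z1E v'E.
  have [T|[c [v1 [v2 [vE pc pc' cm]]]]] := IHb _ _ _ _ _ pb z1E'.
    by left; rewrite tE; apply: thin_at_catr.
  (* Here [b] is the body of the smallest node whose yield contains [v]: its ends [p] and [m] lie on
     the outer sides and its cut point [c] lies on [v]. *)
  left; exists p, c, m, [::], u, v1, v2, t1, z2.
  have bb : k * size b <= k * body_bound by rewrite leq_mul2l (body_boundP Xb) orbT.
  do !split=> //; first by rewrite -z1E'.
    exact: near_leq pc'.
  exact: near_leq cm.
Qed.

(** Appending a fixed walk [f] from [x0] to [xf] turns the closed walk into an accepted one, to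
    whose derivation [yields_thin] applies. If the point found on the third side lies on [f], then
    [x0] replaces it. *)
Lemma context_free_thin f : walk x0 f xf -> exists k', thin_triangles edge x0 k'.
Proof.
(* The [+ 1] covers a cut at the root, where the form is the start symbol alone; [size f] pays for
   moving a point of [f] back to [x0]. *)
move=> x0f; exists (k * (body_bound + 1) + size f) => x y u v t x0u uv vt.
have x0z : walk x0 (u ++ v ++ t ++ f) xf.
  by apply: (walk_catI x0u); apply: (walk_catI uv); apply: (walk_catI vt).
have /derives_yields Sz : derives [:: inl (start G)] (map inr (u ++ v ++ t ++ f)).
  by rewrite -[derives _ _]/(cfg_language G _) langE.
have [a [b [c [[u1 [u2 [uE x0a ax]]] [v1 [v2 [vE xb bY]]] [t1 [t2 [tE x0c cf]]] ab bc]]]] :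
  exists a b c, [/\ on_walk edge x0 u x a, on_walk edge x v y b,
     on_walk edge y (t ++ f) xf c, near (k * (body_bound + 1)) a b
     & near (k * (body_bound + 1)) b c].
  have vtf := walk_catI vt x0f.
  have [[a [b [c [u1 [u2 [v1 [v2 [t1 [t2 [[uE vE tE] [x0a x0b x0c] [ab bc]]]]]]]]]]]|
        [b [v1 [v2 [vE x0b ab bc]]]]] := yields_thin carries_start Sz (erefl _).
    have on s z1 z2 r r' q : walk x0 s q -> walk q (z1 ++ z2) r' -> walk x0 (s ++ z1) r ->
        on_walk edge q (z1 ++ z2) r' r.
      move=> x0s /walk_cat[r1 qr1 r1r'] /walk_cat[q' x0q' q'r].
      rewrite -(walk_det edge_det x0s x0q') in q'r.
      by exists z1, z2; split=> //; rewrite (walk_det edge_det q'r qr1).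
    exists a, b, c; split.
    - by rewrite uE; apply: (on [::]) => //; rewrite -?uE.
    - by rewrite vE; apply: (on u) => //; rewrite -?vE.
    - rewrite tE; apply: (on (u ++ v)); rewrite -?tE -?catA //.
      exact: walk_catI x0u uv.
    - by apply: near_leq ab; rewrite leq_mul2l leq_addr orbT.
    - by apply: near_leq bc; rewrite leq_mul2l leq_addr orbT.
  exists x0, b, xf; split.
  - by exists [::], u.
  - case/walk_cat: x0b => x' x0u' xb; rewrite -(walk_det edge_det x0u x0u') in xb.
    rewrite vE in uv; have /walk_cat[b' xb' b'y] := uv.
    by exists v1, v2; split=> //; rewrite (walk_det edge_det xb xb').
  - by exists (t ++ f), [::]; split; rewrite ?cats0.
  - by apply: near_leq ab; rewrite /= leq_mul2l leq_addl orbT.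
  - by apply: near_leq bc; rewrite /= leq_mul2l leq_addl orbT.
case: (leqP (size t1) (size t)) => t1t.
  have [t3 tE' t2E] := eq_cat_split (esym tE) t1t.
  exists a, b, c; split; [by exists u1, u2|by exists v1, v2| |exact: near_leq (leq_addr _ _) ab|
    exact: near_leq (leq_addr _ _) bc].
  exists t1, t3; split=> //; move: vt; rewrite tE' => /walk_cat[c' yc' c'x0].
  by rewrite (walk_det edge_det x0c yc').
have [t3 t1E fE] := eq_cat_split tE (ltnW t1t).
exists a, b, x0; split; [by exists u1, u2|by exists v1, v2| |exact: near_leq (leq_addr _ _) ab|].
  by exists t, [::]; split; rewrite ?cats0.
apply: near_trans bc _; apply: near_sym => //; exists t3.
  by rewrite fE size_cat leq_addr.
move: x0c; rewrite t1E => /walk_cat[x0' yx0' x0'c].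
by rewrite (walk_det edge_det vt yx0').
Qed.

End ContextFreeToThin.

(** * Thin triangles from trees *)

Section GraphDistance.
Variables (T : eqType) (e : rel T).
Implicit Types (x y : T) (p : seq T).

Lemma gdist_le x y p : path e x p -> last x p = y -> gdist e x y <= size p.
Proof.
move=> xp py; rewrite /gdist; case: pselect => // ex.
by case: ex_minnP => n _; apply; apply/asboolP; exists p.
Qed.

Hypothesis e_conn : forall x y, exists2 p, path e x p & last x p = y.

Lemma gdist_path x y :
  exists p, [/\ path e x p, last x p = y & size p = gdist e x y].
Proof.
rewrite /gdist; case: pselect => [ex|[]].
  by case: ex_minnP => n /asboolP[p xp [py <-]] _; exists p.
by have [p xp py] := e_conn x y; exists (size p); apply/asboolP; exists p.
Qed.

Lemma gdist_triangle x y z : gdist e x z <= gdist e x y + gdist e y z.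
Proof.
have [p [xp py <-]] := gdist_path x y; have [q [yq qz <-]] := gdist_path y z.
by rewrite -size_cat; apply: gdist_le; rewrite ?cat_path ?last_cat py ?xp.
Qed.

Lemma gdist_sym x y : symmetric e -> gdist e x y = gdist e y x.
Proof.
move=> e_sym; suff le x' y' : gdist e y' x' <= gdist e x' y'.
  by apply/eqP; rewrite eqn_leq !le.
have [p [xp <- <-]] := gdist_path x' y'.
rewrite -(size_belast x' p) -size_rev; apply: gdist_le.
  by rewrite rev_path (eq_path (e' := e)).
by case: p {xp} => //= a p; rewrite rev_cons last_rcons.
Qed.

End GraphDistance.

Section Trees.
Variables (T : eqType) (f : rel T).
Hypothesis treeT : is_tree f.

Let f_sym : symmetric f. Proof. by case: treeT. Qed.

(** Otherwise the path, made simple, closes up through [m] to a cycle of length at least 3. *)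
Lemma tree_neighbours_eq m u v p : f m u -> f m v -> path f u p -> last u p = v ->
  m \notin u :: p -> u = v.
Proof.
move=> mu mv up pv mp; case: (eqVneq u v) => // uv; case: treeT => _ _ _ acyc.
move: up pv mp; case/shortenP=> p' up' uniqp' sub pv mp.
case: p' up' uniqp' sub pv => [|b p'] up' uniqp' sub pv.
  by rewrite /= in pv; rewrite pv eqxx in uv.
suff /acyc : ucycle f [:: m, u, b & p'] by [].
apply/andP; split; last first.
  rewrite cons_uniq uniqp' andbT; apply: contra mp; rewrite in_cons (in_cons u).
  by case/orP=> [->//|/sub ->]; rewrite orbT.
by rewrite /= in pv up'; rewrite (cycle_path m) /= pv f_sym mv mu.
Qed.

(** Take [v] simple and let [m] be the first vertex of [u] on [v]. If [m] is not on [w], then its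
    predecessor on [u] and its successor on [v] are joined by a path avoiding [m]; hence they
    coincide, and [m] was not the first. *)
Lemma tree_triangle o p q u v w :
  path f o u -> last o u = p -> path f p v -> last p v = q ->
  path f q w -> last q w = o ->
  exists m, [/\ m \in o :: u, m \in p :: v & m \in q :: w].
Proof.
move=> ou up pv vq qw wo.
wlog : v pv vq / uniq (p :: v).
  move: vq; case/shortenP: pv => v' pv' uniqv' sub v'q /(_ v' pv' v'q uniqv').
  case=> m [mu mv mw]; exists m; split=> //; move: mv; rewrite !inE.
  by case/orP=> [->//|/sub ->]; rewrite orbT.
move=> uniqv; case: (boolP (o \in p :: v)) => [ov|oNv].
  by exists o; split; rewrite ?mem_head // -wo mem_last.
have : has (mem (p :: v)) u.
  apply/hasP; exists p; last exact: mem_head.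
  have := mem_last o u; rewrite up inE => /orP[/eqP pE|//].
  by rewrite pE mem_head in oNv.
move=> hasu; move: ou up; case: (split_find hasu) => m u1 u2 /= mv u1N.
rewrite cat_path rcons_path last_rcons => /andP[/andP[ou1 u1m] mu2] _.
case: (boolP (m \in q :: w)) => mw.
  by exists m; split=> //; rewrite inE mem_cat mem_rcons mem_head orbT.
move: mv mw uniqv pv vq u1N oNv => /=.
case/splitPl=> v1 [|b v2] v1m mw uniqv; rewrite ?cats0 ?cat_path ?last_cat v1m.
  by move=> _ mq; rewrite mq mem_head in mw.
case/andP=> _ /= /andP[mb bv2] v2q u1N oNv.
have bE : b = last o u1.
  apply: (@tree_neighbours_eq m b _ (v2 ++ w ++ u1)) => //.
  - by rewrite f_sym.
  - by rewrite !cat_path bv2 v2q qw wo.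
  - by rewrite !last_cat v2q wo.
  - have mbv2 : m \notin b :: v2.
      move: uniqv; rewrite -cons_uniq -cat_cons cat_uniq => /and3P[_ /hasPn N _].
      by apply/negP => mv2; move/negP: (N _ mv2); rewrite -v1m mem_last.
    move: mw; rewrite in_cons negb_or => /andP[_ mw].
    rewrite -cat_cons !mem_cat (negPf mbv2) (negPf mw) /=.
    apply/negP => mu1; case/hasP: u1N; exists m => //=.
    by rewrite -v1m -cat_cons mem_cat mem_last.
have : b \in p :: v1 ++ b :: v2 by rewrite -cat_cons mem_cat mem_head orbT.
have := mem_last o u1; rewrite -bE inE => /orP[/eqP bo|bu1] bv; first by rewrite -bo bv in oNv.
by case/hasP: u1N; exists b.
Qed.

Lemma tree_conn x y : exists2 p, path f x p & last x p = y.
Proof. by case: treeT. Qed.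

Lemma path_near x p k m : path f x p -> size p <= k -> m \in x :: p ->
  gdist f m x <= k.
Proof.
move=> xp pk mp; rewrite (gdist_sym tree_conn) //.
move: xp pk; case/splitPl: mp => p1 p2 xm; rewrite cat_path size_cat => /andP[xp1 _] pk.
by apply: leq_trans (gdist_le xp1 xm) _; apply: leq_trans pk; rewrite leq_addr.
Qed.

Section CoarseMap.
Variables (L : finType) (V : eqType) (edge : V -> L -> V -> bool).
Variables (psi : V -> T) (J : nat).
Hypothesis psiJ : forall x y, adj edge x y -> gdist f (psi x) (psi y) <= J.

Lemma walk_shadow s u t : walk edge s u t -> exists p, [/\ path f (psi s) p,
  last (psi s) p = psi t & forall m, m \in psi s :: p ->
    exists2 r, on_walk edge s u t r & gdist f m (psi r) <= J].
Proof.
elim: u s => [|a u IHu] s /= => [->|[r sr /[dup] ru /IHu[p [rp pt pP]]]].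
  exists [::]; split=> // m; rewrite inE => /eqP ->; exists t; first by exists [::], [::].
  by apply: leq_trans (gdist_le (p := [::]) _ _) _.
have [q [sq qr qJ]] := gdist_path tree_conn (psi s) (psi r).
have {}qJ : size q <= J by rewrite qJ; apply: psiJ; apply/existsP; exists a.
exists (q ++ p); split; rewrite ?cat_path ?last_cat ?sq ?qr // => m.
rewrite -cat_cons mem_cat => /orP[mq|mp].
  exists s; last exact: path_near sq qJ mq.
  by exists [::], (a :: u); split=> //; exists r.
have [|c [u1 [u2 [-> rc ct]]] mc] := pP m; first by rewrite in_cons mp orbT.
by exists c => //; exists (a :: u1), u2; split=> //; exists r.
Qed.

End CoarseMap.
End Trees.

Section TreeLikeToThin.
Variables (A : finType) (V : eqType) (edge : V -> letter A -> V -> bool).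
Hypothesis edge_conn : forall s t, exists u, walk edge s u t.

Lemma adj_pathP x y n : (exists p, [/\ path (adj edge) x p, last x p = y & size p = n])
  <-> (exists2 u, walk edge x u y & size u = n).
Proof.
split.
  case=> p [+ + <-]; elim: p x => [|z p IHp] x /= => [_ <-|/andP[/existsP[a xz] zp] py].
    by exists [::].
  by have [u zu <-] := IHp _ zp py; exists (a :: u) => //; exists z.
case=> u + <-; elim: u x => [|a u IHu] x /= => [->|[z xz /IHu[p [zp py <-]]]].
  by exists [::].
by exists (z :: p); split=> //=; rewrite zp andbT; apply/existsP; exists a.
Qed.

Lemma adj_conn x y : exists2 p, path (adj edge) x p & last x p = y.
Proof.
have [u xu] := edge_conn x y.
by have [|p [xp py _]] := (adj_pathP x y (size u)).2; [exists u|exists p].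
Qed.

Lemma nearP k x y : near edge k x y <-> gdist (adj edge) x y <= k.
Proof.
split=> [[u uk xu]|xyk].
  have [|p [xp py pu]] := (adj_pathP x y (size u)).2; first by exists u.
  by apply: leq_trans (gdist_le xp py) _; rewrite pu.
have [|u xu uk] := (adj_pathP x y (gdist (adj edge) x y)).1; last by exists u; rewrite ?uk.
exact: gdist_path adj_conn x y.
Qed.

Import Order.TTheory GRing.Theory Num.Theory.

(** The quasi-isometry with natural constants: [J] comes from the upper bound at distance 1, and [k]
    from the lower bound solved for the distance. *)
Lemma tree_like_coarse (R : realType) : tree_like R (adj edge) ->
  exists (T : eqType) (f : rel T), is_tree f /\ exists (psi : V -> T) (J : nat),
  (forall x y, adj edge x y -> gdist f (psi x) (psi y) <= J) /\
  forall n, exists k, forall x y, gdist f (psi x) (psi y) <= n -> near edge k x y.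
Proof.
case=> T [f [treeT [psi [k [K [c [C [N [[k0 K0 c0 C0 _] psiP _]]]]]]]]].
exists T, f; split=> //; exists psi, (Num.bound (K + C)%R); split=> [x y xy|n].
  rewrite -(ler_nat R); case/andP: (psiP x y) => _ /le_trans; apply.
  apply: le_trans (ltW (archi_boundP _)); last by rewrite addr_ge0 // ltW.
  rewrite lerD2r -[leRHS]mulr1 ler_pM2l // (ler_nat R _ 1).
  by apply: (@gdist_le _ _ _ _ [:: y]); rewrite //= xy.
exists (Num.bound ((n%:R + c) / k)%R) => x y xyn; apply/nearP.
rewrite -(ler_nat R); apply: le_trans (ltW (archi_boundP _)); last first.
  by rewrite divr_ge0 ?addr_ge0 // ?ler0n // ltW.
rewrite ler_pdivlMr // mulrC -lerBlDr.
by case/andP: (psiP x y) => /le_trans + _; apply; rewrite ler_nat.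
Qed.

(** The shadows of the three sides share a vertex of the tree. It is within [J] of the image of a
    point on each side, so these images are within [J + J] of each other. *)
Lemma tree_like_thin (R : realType) x0 : tree_like R (adj edge) ->
  exists k, thin_triangles edge x0 k.
Proof.
case/tree_like_coarse=> T [f [treeT [psi [J [psiJ psi_near]]]]].
have [k near_k] := psi_near (J + J); exists k => x y u v t x0u uv vt.
have [p [x0p px pP]] := walk_shadow treeT psiJ x0u.
have [q [xq qy qP]] := walk_shadow treeT psiJ uv.
have [r [yr rx0 rP]] := walk_shadow treeT psiJ vt.
have [m [/pP[a ua ma] /qP[b vb mb] /rP[c tc mc]]] :=
  tree_triangle treeT x0p px xq qy yr rx0.
have f_sym : symmetric f by case: treeT.
exists a, b, c; split=> //; apply: near_k.
  apply: leq_trans (gdist_triangle (tree_conn treeT) _ m _) _; apply: leq_add => //.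
  by rewrite (gdist_sym (tree_conn treeT)).
apply: leq_trans (gdist_triangle (tree_conn treeT) _ m _) _; apply: leq_add => //.
by rewrite (gdist_sym (tree_conn treeT)).
Qed.

End TreeLikeToThin.

(** * Cones and the tree of their frontiers *)

Lemma seq_argmax (T : eqType) (f : T -> nat) (c : seq T) : 0 < size c ->
  exists2 m, m \in c & forall t, t \in c -> f t <= f m.
Proof.
case: c => // m c _; elim: c m => [|m' c IHc] m.
  by exists m; rewrite ?mem_head // => t; rewrite inE => /eqP ->.
have [m1 m1c m1_max] := IHc m'; case: (leqP (f m) (f m1)) => mm1.
  exists m1 => [|t]; rewrite in_cons ?m1c ?orbT //.
  by case/orP=> [/eqP -> //|/m1_max].
exists m => [|t]; rewrite in_cons ?eqxx // => /orP[/eqP -> //|/m1_max] tm1.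
by apply: leq_trans tm1 (ltnW mm1).
Qed.

Section Heights.
Variables (A : finType) (V : choiceType) (edge : V -> letter A -> V -> bool).
Hypotheses (edge_det : deterministic edge) (edge_inv : invertible edge).
Hypothesis edge_conn : forall s t, exists u, walk edge s u t.
Variables (x0 xf : V) (w : word A).
Hypothesis x0w : walk edge x0 w xf.
Local Notation walk := (walk edge).
Local Notation near := (near edge).

(** Heights are measured from the whole walk [w] and not only from [x0], so that [w] stays outside
    the cones of positive level. *)
Definition base s := on_walk edge x0 w xf s.

Lemma base_x0 : base x0. Proof. by exists [::], w. Qed.
Lemma base_xf : base xf. Proof. by exists w, [::]; rewrite cats0. Qed.

Lemma base_walk w1 w2 s : w = w1 ++ w2 -> walk x0 w1 s -> base s.
Proof.
move=> wE x0s; exists w1, w2; split=> //; move: x0w; rewrite wE.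
by case/walk_cat=> r x0r; rewrite (walk_det edge_det x0s x0r).
Qed.

Lemma height_subproof x : exists n, `[< exists2 s, base s & near n s x >].
Proof.
have [u x0x] := edge_conn x0 x; exists (size u); apply/asboolP; exists x0.
  exact: base_x0.
by exists u.
Qed.

Definition height x := ex_minn (height_subproof x).
Local Notation h := height.

Lemma height_near x : exists2 s, base s & near (h x) s x.
Proof. by rewrite /h; case: ex_minnP => n /asboolP. Qed.

Lemma height_le n s x : base s -> near n s x -> h x <= n.
Proof.
rewrite /h; case: ex_minnP => m _ + bs sx; apply; apply/asboolP.
by exists s.
Qed.

Lemma height0 x : h x = 0 <-> base x.
Proof.
split=> [x0E|bx]; last by have := height_le bx (near0 edge 0 x); lia.
have [s bs [u]] := height_near x; rewrite x0E leqn0 => /nilP -> /= sx.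
by rewrite -sx.
Qed.

Lemma height_near_le k x y : near k x y -> h y <= h x + k.
Proof.
by move=> xy; have [s bs sx] := height_near x; exact: (height_le bs (near_trans sx xy)).
Qed.

Lemma height_edge x a y : edge x a y -> h y <= (h x).+1.
Proof. by move/near1/height_near_le; rewrite addn1. Qed.

Lemma height_pred x : 0 < h x -> exists a y, edge y a x /\ h x = (h y).+1.
Proof.
move=> hx; have [s bs [u]] := height_near x.
case/lastP: u => [|u a] us sx; first by move: sx hx => /= <-; have := (height0 s).2 bs; lia.
move: sx; rewrite -cats1 => /walk_cat[y sy /walk1 yx]; exists a, y; split=> //.
have := height_edge yx; have : h y <= size u by apply: (height_le bs); exists u.
by move: us; rewrite size_rcons; lia.
Qed.

Definition same_cone n x y := exists u, walk_in edge (fun z => n <= h z) x u y.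

Lemma same_cone_refl n x : same_cone n x x. Proof. by exists [::]. Qed.

Lemma same_cone_sym n x y : same_cone n x y -> same_cone n y x.
Proof.
by move=> [u xu]; exists (winv u); apply: walk_inv xu; apply: invertible_in.
Qed.

Lemma same_cone_trans n x y z : same_cone n x y -> same_cone n y z -> same_cone n x z.
Proof. by move=> [u xu] [v yv]; exists (u ++ v); apply: walk_catI yv. Qed.

Lemma same_cone_leq m n x y : m <= n -> same_cone n x y -> same_cone m x y.
Proof.
move=> mn [u xy]; exists u; apply: walk_subset xy => z; exact: leq_trans.
Qed.

Lemma same_cone_edge n x a y : n <= h x -> n <= h y -> edge x a y -> same_cone n x y.
Proof. by move=> nx ny xy; exists [:: a]; apply/walk1/edge_inP. Qed.

Lemma height_geodesic x : exists2 u, walk x0 u x &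
  forall a, on_walk edge x0 u x a -> near (size w + (h x - h a)) a x.
Proof.
have [s bs [g gs sx]] := height_near x; have [w1 [w2 [wE x0s sxf]]] := bs.
exists (w1 ++ g) => [|a [u1 [u2 [uE x0a ax]]]]; first exact: walk_catI sx.
case: (leqP (size u1) (size w1)) => uw.
  have [e w1E u2E] := eq_cat_split (esym uE) uw.
  have ha : h a = 0.
    by apply/height0; apply: (base_walk (w2 := e ++ w2)) x0a; rewrite [LHS]wE w1E catA.
  exists u2 => //; move: (congr1 size wE); rewrite ha u2E w1E !size_cat; simpl in *; lia.
have [e u1E gE] := eq_cat_split uE (ltnW uw).
exists u2 => //; have : h a <= size e.
  apply: (height_le bs); exists e => //.
  move: x0a; rewrite u1E => /walk_cat[s' x0s' s'a].
  by rewrite (walk_det edge_det x0s x0s').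
by move: gs; rewrite gE size_cat; lia.
Qed.

(** The middle side stays at height at least [h x], so [a] and [c], being within [k] of its point
    [b], have height at least [h x - k]. Hence they are within [size w + k] of [x] and [y]. *)
Lemma thin_frontier k : thin_triangles edge x0 k -> exists D, forall x y,
  h x = h y -> same_cone (h x) x y -> near D x y.
Proof.
move=> thin; exists (size w + k + (k + k) + (size w + k)) => x y xyh [v xv].
have [u x0u uP] := height_geodesic x; have [t x0t tP] := height_geodesic y.
have [a [b [c [/uP ax [v1 [v2 [vE xb _]]] [t1 [t2 [tE yc cx0]]] ab bc]]]] :=
  thin _ _ _ _ _ x0u (walk_sub xv) (walk_inv edge_inv x0t).
have {cx0 t1 t2 tE yc} cy : near (size w + (h y - h c)) c y.
  apply: tP; exists (winv t2), (winv t1); split.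
  - by rewrite -winv_cat -tE winvK.
  - exact: walk_inv.
  - exact: walk_inv.
have hb : h x <= h b.
  move: xv; rewrite vE => /walk_cat[b' xb' _].
  rewrite (walk_det edge_det xb (walk_sub xb')).
  exact: (@walk_in_end _ _ edge (fun z => h x <= h z)) xb'.
have ba := near_sym edge_inv ab.
have hab := height_near_le ab; have hcb := height_near_le (near_sym edge_inv bc).
apply: near_trans; last by apply: near_leq cy; lia.
apply: near_trans; last exact: near_trans ab bc.
by apply: near_sym => //; apply: near_leq ax; lia.
Qed.

Section LevelTree.
Variable D : nat.
Hypothesis frontier_near : forall x y, h x = h y -> same_cone (h x) x y -> near D x y.

(* A class of siblings is a frontier, and stands for its cone. *)
Definition sibling : rel V := fun x y => `[< h x = h y /\ same_cone (h x) x y >].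

Lemma sibling_refl : reflexive sibling.
Proof. by move=> x; apply/asboolP; split=> //; apply: same_cone_refl. Qed.

Lemma sibling_sym : symmetric sibling.
Proof.
suff sym x y : sibling x y -> sibling y x by move=> x y; apply/idP/idP; apply: sym.
by move=> /asboolP[xy /same_cone_sym yx]; apply/asboolP; rewrite -xy.
Qed.

Lemma sibling_trans : transitive sibling.
Proof.
move=> y x z /asboolP[xy cxy] /asboolP[yz cyz]; apply/asboolP.
by split; [rewrite xy | apply: same_cone_trans cxy _; rewrite xy].
Qed.

Local Canonical sibling_equiv := EquivRel sibling sibling_refl sibling_sym sibling_trans.

Definition level_node : choiceType := {eq_quot sibling}%qT.
Definition node (x : V) : level_node := \pi_({eq_quot sibling})%qT x.

Lemma nodeP x y : node x = node y <-> h x = h y /\ same_cone (h x) x y.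
Proof. by split=> [/eqmodP/asboolP|?]; last apply/eqmodP/asboolP. Qed.

Lemma node_onto t : exists x, t = node x.
Proof. by exists (repr t); rewrite /node reprK. Qed.

(** Adjacent vertices of equal height have the same node, so [h x <> h y] excludes loops. *)
Definition level_edge : rel level_node := fun t t' =>
  `[< exists x y, [/\ node x = t, node y = t', adj edge x y & h x <> h y] >].

Lemma adj_sym : symmetric (adj edge).
Proof.
suff sym x y : adj edge x y -> adj edge y x by move=> x y; apply/idP/idP; apply: sym.
by case/existsP=> a /edge_inv yx; apply/existsP; exists (linv a).
Qed.

Lemma adj_height x y : adj edge x y -> h y <= (h x).+1.
Proof. by case/existsP=> a /height_edge. Qed.

Lemma level_edge_sym : symmetric level_edge.
Proof.
suff sym x y : level_edge x y -> level_edge y x by move=> x y; apply/idP/idP; apply: sym.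
case/asboolP=> s [t [sx ty st hst]]; apply/asboolP; exists t, s; split=> //.
by rewrite adj_sym.
by move/esym.
Qed.

Lemma node_adj x y : adj edge x y -> node x = node y \/ level_edge (node x) (node y).
Proof.
move=> xy; have [hxy|hxy] := eqVneq (h x) (h y).
  left; apply/nodeP; split=> //; case/existsP: xy => a; apply: same_cone_edge => //.
  by rewrite hxy.
by right; apply/asboolP; exists x, y; split=> //; apply/eqP.
Qed.

Lemma node_path x p : path (adj edge) x p -> exists q,
  [/\ path level_edge (node x) q, last (node x) q = node (last x p) & size q <= size p].
Proof.
elim: p x => [|y p IHp] x /=; first by exists [::].
case/andP=> /node_adj xy /IHp[q [yq qp qs]].
case: xy => [->|xy]; first by exists q; split=> //; apply: leqW.
by exists (node y :: q); rewrite /= xy.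
Qed.

(** The lower ends are joined through [x] and [x'], which lie in one cone, without going below their
    own level. So a node has at most one parent. *)
Lemma level_parent x y x' y' : node x = node x' -> adj edge x y -> adj edge x' y' ->
  h y < h x -> h y' < h x' -> node y = node y'.
Proof.
case/nodeP=> hx cx xy xy' hy hy'; have := adj_height xy'; have := adj_height xy.
have := xy; rewrite adj_sym => /adj_height; have := xy'; rewrite adj_sym => /adj_height.
move=> hxy' hxy _ _; apply/nodeP; split; first by lia.
case/existsP: xy => a /edge_inv yx; case/existsP: xy' => a' xy'.
apply: (@same_cone_trans _ _ x); first by apply: same_cone_edge yx => //; lia.
apply: (@same_cone_trans _ _ x'); last by apply: same_cone_edge xy' => //; lia.
by apply: same_cone_leq cx; lia.
Qed.

Definition node_height (t : level_node) := h (repr t).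

Lemma node_heightE x : node_height (node x) = h x.
Proof.
rewrite /node_height; have : node (repr (node x)) = node x by rewrite /node reprK.
by case/nodeP.
Qed.

Lemma level_tree : is_tree level_edge.
Proof.
split=> [|t|t t'|c].
- exact: level_edge_sym.
- apply/asboolP => -[x [y [<- /nodeP[/esym]]]] //.
- have [[x ->] [y ->]] := (node_onto t, node_onto t').
  have [p /node_path[q [xq qp _]] <-] := adj_conn edge_conn x y; exists q => //.
rewrite leqNgt => /andP[cyc_c uniq_c]; apply/negP => c3.
(* Both neighbours of a highest node [m] of the cycle are lower, so both are its unique parent. *)
have [m mc m_max] := @seq_argmax _ node_height c (ltnW (ltnW c3)).
have [i c' cE] := rot_to mc; move: cyc_c uniq_c c3 m_max.
rewrite -(rot_cycle i) -(rot_uniq i) -(size_rot i) cE.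
case: c' cE => [|a [|b c']] cE // cyc uniq_c _ m_max.
have {m_max} mx t : t \in m :: a :: b :: c' -> node_height t <= node_height m.
  by rewrite -cE mem_rot; apply: m_max.
have lower t t' : level_edge m t -> level_edge m t' -> t \in m :: a :: b :: c' ->
    t' \in m :: a :: b :: c' -> t = t'.
  move=> /asboolP[x [y [xm <- xy hxy]]] /asboolP[x' [y' [x'm <- xy' hxy']]] /mx + /mx.
  rewrite -{1}xm -x'm !node_heightE => hy hy'.
  by apply: (level_parent _ xy xy'); [rewrite xm|lia|lia].
have ab : a = last b c'.
  apply: lower; rewrite ?in_cons ?eqxx ?orbT //.
  - by case/andP: cyc.
  - by move: cyc; rewrite /= rcons_path => /and4P[_ _ _]; rewrite level_edge_sym.
  - by have := mem_last b c'; rewrite in_cons => ->; rewrite !orbT.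
by move: uniq_c; rewrite /= ab mem_last andbF.
Qed.

Import Order.TTheory GRing.Theory Num.Theory.

Lemma node_gdist_le x y : gdist level_edge (node x) (node y) <= gdist (adj edge) x y.
Proof.
have [p [xp py <-]] := gdist_path (adj_conn edge_conn) x y.
have [q [xq qp]] := node_path xp; rewrite py in qp.
exact: leq_trans (gdist_le xq qp).
Qed.

(** Each step costs at most [D] inside a frontier and one edge to the next; the last frontier costs
    another [D]. *)
Lemma level_path_near x q y : path level_edge (node x) q -> last (node x) q = node y ->
  near (size q * D.+1 + D) x y.
Proof.
elim: q x => [|t q IHq] x /=; first by move=> _ /nodeP[hxy /(frontier_near hxy)].
move=> /andP[/asboolP[x' [z [/esym/nodeP[hx cx] <- /existsP[a x'z] _]]] zq] qy.
apply: near_leq (near_trans (frontier_near hx cx) (near_trans (near1 x'z) (IHq _ zq qy))).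
by rewrite addnA addn1 mulSn addnA.
Qed.

Lemma frontier_tree_like (R : realType) : tree_like R (adj edge).
Proof.
exists level_node, level_edge; split; first exact: level_tree.
(* The additive constant 1 absorbs the final [D], as [n * D.+1 + D <= (n + 1) * D.+1]. *)
exists node, (D.+1%:R^-1)%R, 1%R, 1%R, 1%R, 1%R; split=> [|x y|t].
- by split; rewrite // invr_gt0 ltr0n.
- apply/andP; split; last first.
    by rewrite mul1r (le_trans (y := (gdist (adj edge) x y)%:R)%R) ?ler_nat ?node_gdist_le // lerDl.
  rewrite lerBlDr mulrC ler_pdivrMr ?ltr0n //.
  rewrite mulrDl mul1r -natrM -natrD ler_nat; apply/nearP => //.
  have [q [xq qy <-]] := gdist_path (tree_conn level_tree) (node x) (node y).
  by apply: near_leq (level_path_near xq qy); rewrite leq_add2l.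
- have [x ->] := node_onto t; exists x.
  rewrite (le_trans (y := 0%:R)%R) // ler_nat.
  exact: (gdist_le (p := [::])).
Qed.

End LevelTree.

End Heights.

(** * Cones are forced by their frontiers *)

Section ConeTransfer.
Variables (A : finType) (V : choiceType) (edge : V -> letter A -> V -> bool).
Hypotheses (edge_det : deterministic edge) (edge_inv : invertible edge).
Local Notation walk := (walk edge).
Local Notation near := (near edge).

(* The Schutzenberger graph of [w] maps to every such graph [E] that reads [w]. *)
Definition universal rels (x0 : V) w :=
  forall (Q : eqType) (E : Q -> letter A -> Q -> bool),
  deterministic E -> invertible E -> respects E rels ->
  forall s t, Defs.walk E s w t -> forall u v x, walk x0 u x -> walk x0 v x ->
  exists2 y, Defs.walk E s u y & Defs.walk E s v y.

Variables (rels : seq (word A * word A)) (x0 xf : V) (w : word A).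
Hypothesis edge_rels : respects edge rels.
Hypothesis edge_univ : universal rels x0 w.

Variables (C : pred V) (F : V -> Prop) (D l rho : nat).
Definition near_frontier k x := exists2 f, F f & near k f x.
(** Room for walks of length [D] between frontier vertices, and for reading a relator from any
    vertex within [l + 1] of the frontier. *)
Definition radius := D + 2 * l + 2.
Local Notation r := radius.
Definition cone_nbhd x := C x \/ near_frontier r x.

Hypothesis size_rels : forall u v, (u, v) \in rels -> size u <= l /\ size v <= l.
Hypothesis rhoP : D + r < rho.
Hypothesis cut_F : forall x a y, edge x a y -> C x -> ~~ C y -> F x.
Hypothesis F_near : forall x y, F x -> F y -> near D x y.
(** The first alternative is the cone of level 0, with [w] along its frontier; the second is a cone
    of positive level, entered from outside. *)
Hypothesis cone_start : F x0 /\ walk_in edge F x0 w xf \/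
  walk_in edge (fun x => ~~ C x) x0 w xf /\ exists z x a y,
  [/\ walk_in edge (fun x => ~~ C x) x0 z x, ~~ C x, edge x a y & F y].
Variables (f p : V).
Hypothesis Ff : F f.

Hypothesis p_sat : forall u v x, size u <= rho -> size v <= rho ->
  walk_in edge cone_nbhd f u x -> walk_in edge cone_nbhd f v x ->
  exists2 y, walk p u y & walk p v y.

Lemma near_frontier_leq k k' x : k <= k' -> near_frontier k x -> near_frontier k' x.
Proof. by move=> kk' [g Fg gx]; exists g => //; apply: near_leq gx. Qed.

Lemma near_frontier_step k x a y : edge x a y -> near_frontier k x -> near_frontier k.+1 y.
Proof.
by move=> /near1 xy [g Fg gx]; exists g => //; rewrite -addn1; apply: near_trans xy.
Qed.

Lemma near_frontier0 k x : F x -> near_frontier k x.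
Proof. by exists x => //; apply: near0. Qed.

Lemma cut_near x a y : edge x a y -> C x != C y -> near_frontier 1 x /\ near_frontier 1 y.
Proof.
move=> xy; have yx := edge_inv xy.
case Cx: (C x); case Cy: (C y) => // _.
  have Fx : F x by apply: cut_F xy _ _; rewrite ?Cx ?Cy.
  by split; [apply: near_frontier0 | apply: near_frontier_step xy (near_frontier0 0 Fx)].
have Fy : F y by apply: cut_F yx _ _; rewrite ?Cx ?Cy.
by split; [apply: near_frontier_step yx (near_frontier0 0 Fy) | apply: near_frontier0].
Qed.

Lemma near_walk_in k x u y : near_frontier k x -> k + size u <= r -> walk x u y ->
  walk_in edge (near_frontier r) x u y.
Proof.
move=> [g Fg gx] ku xu; apply: walk_edge_in xu _ => u1 u2 z uE xz.
exists g => //; apply: near_leq (near_trans gx (ex_intro2 _ _ u1 (leqnn _) xz)).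
by apply: leq_trans ku; rewrite uE size_cat leq_add2l leq_addr.
Qed.

Lemma frontier_reach g x : F g -> near_frontier r x ->
  exists2 u, size u <= D + r & walk_in edge (near_frontier r) g u x.
Proof.
move=> Fg [g' Fg' [v vr g'x]]; have [u uD gg'] := F_near Fg Fg'.
exists (u ++ v); first by rewrite size_cat leq_add.
apply: (@walk_catI _ _ _ _ _ g').
  by apply: (near_walk_in (near_frontier0 0 Fg)) gg'; apply: leq_trans uD _; rewrite /r; lia.
exact: (near_walk_in (near_frontier0 0 Fg')) g'x.
Qed.

Lemma frontier_nbhd x u y : walk_in edge (near_frontier r) x u y ->
  walk_in edge cone_nbhd x u y.
Proof. by apply: walk_subset => z; right. Qed.

(** The copy of [x] near [p]. By [p_sat] it does not depend on the short word [u]; the value [p] is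
    junk when there is no such word. *)
Definition lift x := xget p [set d |
  exists u, [/\ size u <= D + r, walk_in edge cone_nbhd f u x & walk p u d]].

Lemma liftP u x : near_frontier r x -> size u <= rho ->
  walk_in edge cone_nbhd f u x -> walk p u (lift x).
Proof.
move=> Fx urho fx; rewrite /lift; case: xgetP => [d _ [v [vr fvx pv]]|none].
  have [|y pu pv'] := p_sat urho _ fx fvx; first exact: leq_trans (ltnW rhoP).
  by rewrite (walk_det edge_det pv pv').
have [v vr /frontier_nbhd fvx] := frontier_reach Ff Fx.
have vrho : size v <= rho by apply: leq_trans (ltnW rhoP).
by have [y pv _] := p_sat vrho vrho fvx fvx; case: (none y); exists v.
Qed.

Lemma lift_base : lift f = p.
Proof.
exact: esym (liftP (u := [::]) (near_frontier0 r Ff) (leq0n _) (erefl _)).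
Qed.

Lemma lift_edge x a y : near_frontier r x -> near_frontier r y -> edge x a y ->
  edge (lift x) a (lift y).
Proof.
move=> Fx Fy xy; have [u ur /frontier_nbhd fx] := frontier_reach Ff Fx.
have fy : walk_in edge cone_nbhd f (rcons u a) y.
  by apply: walk_rcons fx _; apply/edge_inP; split=> //; right.
(* The strict inequality in [rhoP] leaves room for the extra letter [a]. *)
have := liftP Fy _ fy; rewrite size_rcons (leq_ltn_trans ur rhoP) => /(_ isT).
rewrite -cats1 => /walk_cat[z pz /walk1 zy].
have px := liftP Fx (leq_trans ur (ltnW rhoP)) fx.
by rewrite (walk_det edge_det px pz).
Qed.

(* Two sheets over the graph: itself, with states [(None, x)], and its product
   with a copy that is explored from [p] while the second component is explored
   from [f], with states [(Some d, x)].  The edges leaving the cone are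
   crossed over between [(None, x)] and [(Some (lift x), x)].  Short walks
   cannot see the crossing, so the relators are still respected; but a walk
   that enters the cone from outside changes sheet, so the universal property
   carries the cone to the second sheet. *)
Local Notation state := (option V * V)%type.
Implicit Types s t : state.

Definition sheet_edge (o : option V) a (o' : option V) :=
  match o, o' with
  | None, None => true | Some d, Some d' => edge d a d' | _, _ => false
  end.

Definition aligned s := if s.1 is Some d then d == lift s.2 else true.

Definition glued s a t := edge s.2 a t.2 &&
  if (C s.2 != C t.2) && aligned s
  then t.1 == (if s.1 is Some _ then None else Some (lift t.2))
  else sheet_edge s.1 a t.1.

Lemma glued_proj s u t : Defs.walk glued s u t -> walk s.2 u t.2.
Proof. by apply: (walk_morph (phi := snd)) => x a y /andP[]. Qed.

Lemma glued_det : deterministic glued.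
Proof.
move=> s a [o x] [o' x'] /andP[/= sx oE] /andP[/= sx' o'E].
have xx' := edge_det sx sx'; rewrite -{}xx' in o'E *; congr pair.
move: oE o'E; case: ifP => _; first by move=> /eqP -> /eqP ->.
rewrite /sheet_edge; case: s.1 o o' => [d|] [d1|] [d2|] // dd1 dd2.
by rewrite (edge_det dd1 dd2).
Qed.

Lemma near_frontier1r x : near_frontier 1 x -> near_frontier r x.
Proof. by apply: near_frontier_leq; rewrite /r; lia. Qed.

Lemma glued_inv : invertible glued.
Proof.
move=> [o x] a [o' y] /andP[/= xy oE]; apply/andP; split; first exact: edge_inv.
move: oE; rewrite /= [C y == _]eq_sym; case Cxy: (C x == C y) => /=.
  by case: o o' => [d|] [d'|] //; apply: edge_inv.
have [/near_frontier1r Fx /near_frontier1r Fy] := cut_near xy (negbT Cxy).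
have lxy := lift_edge Fx Fy xy; have lyx := edge_inv lxy.
rewrite /aligned /=; case: o => [d|]; last by move=> /eqP ->; rewrite eqxx.
case: eqP => [-> /eqP -> //|dx]; case: o' => [d'|] //= dd'.
case: eqP => [d'y|_]; last exact: edge_inv.
(* If the target were aligned, the inverse edge would lead back to [lift x], and the source would be
   aligned too. *)
by case: dx; apply: edge_det (edge_inv dd') _; rewrite d'y.
Qed.

(* Near the frontier these two sections trivialize the crossed double cover. *)
Definition section_of b x : state := (if C x (+) b then Some (lift x) else None, x).

Lemma aligned_section s : aligned s -> exists b, s = section_of b s.2.
Proof.
case: s => [[d|] x]; rewrite /aligned /section_of /=.
  by move=> /eqP ->; exists (~~ C x); rewrite addbN addbb.
by exists (C x); rewrite addbb.
Qed.

Lemma section_edge b x a y : near_frontier r x -> near_frontier r y -> edge x a y ->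
  glued (section_of b x) a (section_of b y).
Proof.
move=> Fx Fy xy; have lxy := lift_edge Fx Fy xy.
rewrite /glued /aligned /section_of /= xy /=.
by case: (C x) (C y) b => [] [] [] //=; rewrite ?eqxx.
Qed.

Lemma section_walk b k x u y : near_frontier k x -> k + size u <= r -> walk x u y ->
  Defs.walk glued (section_of b x) u (section_of b y).
Proof.
move=> Fx ku /(near_walk_in Fx ku); apply: walk_morph => z a t /edge_inP[zt Fz Ft].
exact: section_edge.
Qed.

Definition product_edge s a t := edge s.2 a t.2 && sheet_edge s.1 a t.1.

Lemma product_walkP s u t : Defs.walk product_edge s u t <-> walk s.2 u t.2 /\
  match s.1, t.1 with
  | None, None => True | Some d, Some d' => walk d u d' | _, _ => False
  end.
Proof.
case: t => o' y; elim: u s => [|a u IHu] [o x] /=.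
  by split=> [[-> ->]|]; case: o o' => [d|] [d'|] //=; case=> -> // ->.
split.
  case=> -[o1 z] /andP[/= xz oo1] /IHu[/= zy o1o']; split; first by exists z.
  by case: o o1 oo1 o1o' => [d|] [d1|] //; case: (o') => [d'|] // dd1 d1d'; exists d1.
case=> -[z xz zy]; case: o o' IHu => [d|] [d'|] // IHu.
  case=> d1 dd1 d1d'; exists (Some d1, z); first by rewrite /product_edge /= xz.
  exact/IHu.
by move=> _; exists (None, z); [rewrite /product_edge /= xz | apply/IHu].
Qed.

(** Crossings start only at aligned states within 1 of the frontier. So a walk of length at most [k]
    from such a state uses none, provided [k.+2 <= r]. *)
Definition far k s := ~ (near_frontier k.+1 s.2 /\ aligned s).

Lemma far_glued k s a t : far k s -> glued s a t = product_edge s a t.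
Proof.
move=> far_s; rewrite /glued /product_edge; case st: (edge _ _ _) => //=.
case: ifP => // /andP[/(cut_near st)[Fs _] al]; case: far_s; split=> //.
exact: near_frontier_leq Fs.
Qed.

(** Near the frontier [lift] preserves edges, so by determinism alignment of [t] passes back to
    [s]. *)
Lemma far_step k s a t : k.+3 <= r -> far k.+1 s -> product_edge s a t -> far k t.
Proof.
case: s t => [o x] [o' y] kr far_s /andP[/= xy oo'] [/= Fy al]; apply: far_s.
have Fx := near_frontier_step (edge_inv xy) Fy; split=> //=.
move: al oo'; rewrite /aligned /=; case: o o' => [d|] [d'|] //= /eqP -> dly.
have lxy := lift_edge (near_frontier_leq (ltnW kr) Fx)
                      (near_frontier_leq (ltnW (ltnW kr)) Fy) xy.
by apply/eqP; apply: edge_det (edge_inv dly) (edge_inv lxy).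
Qed.

Lemma far_walk k u s t : size u <= k -> k.+2 <= r -> far k s ->
  Defs.walk glued s u t <-> Defs.walk product_edge s u t.
Proof.
elim: u k s => [|a u IHu] [|k] s //= uk kr far_s.
have E q : glued s a q = product_edge s a q := far_glued a q far_s.
have IH q : product_edge s a q -> Defs.walk glued q u t <-> Defs.walk product_edge q u t.
  by move=> sq; apply: (IHu k) => //; [apply: ltnW | apply: far_step sq].
split=> -[q sq qt]; exists q; rewrite ?E // in sq *; exact/(IH q sq).
Qed.

(** Near an aligned state both sides of a relator are read inside one section, which is a copy of
    the graph. From a far state no crossing is met, and the product respects relators in each
    component. *)
Lemma glued_respects : respects glued rels.
Proof.
have half u v s t : size u <= l -> size v <= l ->
    (forall x y, walk x u y -> walk x v y) ->
    Defs.walk glued s u t -> Defs.walk glued s v t.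
  move=> ul vl uv st; have lr : l.+2 <= r by rewrite /r; lia.
  case: (pselect (near_frontier l.+1 s.2 /\ aligned s)) => [[Fs /aligned_section[b sE]]|far_s].
    have sut := glued_proj st; have Fl x : x <= l -> l.+1 + x <= r by rewrite /r; lia.
    have sub := section_walk b Fs (Fl _ ul) sut; rewrite -sE in sub.
    have -> : t = section_of b t.2 by apply: (walk_det glued_det st sub).
    by rewrite sE; apply: section_walk Fs (Fl _ vl) (uv _ _ sut).
  apply/(far_walk _ vl lr far_s)/product_walkP.
  have /product_walkP[/uv ? o] := (far_walk _ ul lr far_s).1 st; split=> //.
  by case: s.1 t.1 o => [d|] [d'|] //; apply: uv.
move=> u v uv s t; have [ul vl] := size_rels uv.
by split; apply: half => // x y; have [] := edge_rels uv x y.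
Qed.

(** On the first sheet if [x0] is outside the cone, on the second if the cone contains [x0]. *)
Definition start_state := section_of false x0.

Lemma outside_section x a y : ~~ C x -> ~~ C y -> edge x a y ->
  glued (section_of false x) a (section_of false y).
Proof.
move=> Cx Cy xy; rewrite /glued /section_of /= xy /=.
by rewrite (negPf Cx) (negPf Cy) /=.
Qed.

Lemma start_reads : exists t, Defs.walk glued start_state w t.
Proof.
exists (section_of false xf); case: cone_start => [[_]|[+ _]].
  apply: walk_morph => x a y /edge_inP[xy Fx Fy].
  by apply: section_edge xy; apply: near_frontier0.
by apply: walk_morph => x a y /edge_inP[xy Cx Cy]; apply: outside_section.
Qed.

(* The graph of the morphism given by the universal property. *)
Definition image x t := exists2 z, walk x0 z x & Defs.walk glued start_state z t.

Lemma image_univ u v x : walk x0 u x -> walk x0 v x ->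
  exists2 t, Defs.walk glued start_state u t & Defs.walk glued start_state v t.
Proof.
have [t st] := start_reads.
exact: (edge_univ glued_det glued_inv glued_respects st).
Qed.

Lemma image_fun x t t' : image x t -> image x t' -> t = t'.
Proof.
move=> [u xu su] [v xv sv]; have [q su' sv'] := image_univ xu xv.
by rewrite (walk_det glued_det su su') (walk_det glued_det sv sv').
Qed.

Lemma image_edge x t a y : image x t -> edge x a y -> exists2 t', image y t' & glued t a t'.
Proof.
move=> [u xu su] xy; have yu := walk_rcons xu xy.
have [t' st' _] := image_univ yu yu; exists t'; first by exists (rcons u a).
move: st'; rewrite -cats1 => /walk_cat[q sq /walk1].
by rewrite (walk_det glued_det su sq).
Qed.

Lemma image_walk x t u t' : image x t -> Defs.walk glued t u t' -> image t'.2 t'.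
Proof.
move=> [v xv sv] tt'; exists (v ++ u); last exact: walk_catI tt'.
by apply: (walk_catI xv); have := glued_proj tt'; rewrite -(walk_det edge_det xv (glued_proj sv)).
Qed.

(** By [cone_start] some frontier vertex is reached along the section; from there the section reads
    every walk that stays near the frontier. *)
Lemma image_near x : near_frontier r x -> image x (section_of false x).
Proof.
move=> Fx; have [g [Fg img]] : exists g, F g /\ image g (section_of false g).
  case: cone_start => [[Fx0 _]|[_ [z [y [a [g [x0z Cy yg Fg]]]]]]].
    by exists x0; split=> //; exists [::].
  exists g; split=> //; exists (rcons z a).
    exact: walk_rcons (walk_sub x0z) yg.
  apply: (@walk_rcons _ _ _ _ _ (section_of false y)).
    by apply: walk_morph x0z => ? ? ? /edge_inP[? ? ?]; apply: outside_section.
  apply: (section_edge _ _ _ yg); last exact: near_frontier0.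
  apply: near_frontier1r; apply: near_frontier_step (edge_inv yg) (near_frontier0 0 Fg).
have [u _ gx] := frontier_reach Fg Fx.
apply: (image_walk img (t' := section_of false x) (u := u)).
by apply: walk_morph gx => y a z /edge_inP[yz Fy Fz]; apply: section_edge.
Qed.

(** Extends [lift] over the whole cone. Inside the cone the value is the first component of the
    image; outside, the image is on the first sheet near the frontier, and [lift] is used
    instead. *)
Definition transferred x d :=
  if C x then image x (Some d, x) else near_frontier r x /\ d = lift x.

Lemma transferred_near x d : near_frontier r x -> transferred x d <-> d = lift x.
Proof.
move=> Fx; rewrite /transferred; case Cx: (C x); last by split=> [[]|].
have := image_near Fx; rewrite /section_of Cx /= => img.
by split=> [/(image_fun img)[]|->].
Qed.

Lemma transferred_fun x d d' : transferred x d -> transferred x d' -> d = d'.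
Proof.
rewrite /transferred; case: ifP => _; last by move=> [_ ->] [_ ->].
by move=> im /(image_fun im)[].
Qed.

(** An edge inside the cone has an image without crossing. Any other edge of the neighbourhood has
    both ends near the frontier, where [transferred] is [lift]. *)
Lemma transferred_edge x a y d : edge x a y -> cone_nbhd x -> cone_nbhd y ->
  transferred x d -> exists2 d', edge d a d' & transferred y d'.
Proof.
move=> xy Nx Ny; case Cxy: (C x && C y).
  case/andP: Cxy => Cx Cy; rewrite /transferred Cx => /image_edge/(_ xy)[[o y'] im].
  rewrite /glued /= Cx; case: im => u x0y sy.
  have /= y'E := walk_det edge_det x0y (glued_proj sy); rewrite -y'E Cy /= in sy *.
  by rewrite xy /= /sheet_edge; case: o sy => // d' sy dd'; exists d' => //; exists u.
have [Fx Fy] : near_frontier r x /\ near_frontier r y.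
  case Cx: (C x) Cxy Nx => /= Cy Nx; case: Ny => [Cy'|Fy].
  - by rewrite Cy' in Cy.
  - by have := cut_near xy; rewrite Cx Cy => /(_ isT)[/near_frontier1r].
  - by have := cut_near xy; rewrite Cx Cy' => /(_ isT)[/near_frontier1r + /near_frontier1r].
  - by case: Nx => //; rewrite Cx.
move=> /(transferred_near _ Fx) ->; exists (lift y); first exact: lift_edge.
exact/transferred_near.
Qed.

Lemma transferred_walk x u y d : walk_in edge cone_nbhd x u y ->
  transferred x d -> exists2 d', walk d u d' & transferred y d'.
Proof.
elim: u x d => [|a u IHu] x d /= => [<- xd|[z /edge_inP[xz Nx Nz] zy] xd].
  by exists d.
have [d1 dd1 zd1] := transferred_edge xz Nx Nz xd.
by have [d' d1d' yd'] := IHu _ _ zy zd1; exists d' => //; exists d1.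
Qed.

Lemma cone_transfer u v x : walk_in edge cone_nbhd f u x -> walk_in edge cone_nbhd f v x ->
  exists2 y, walk p u y & walk p v y.
Proof.
move=> fu fv; have fp : transferred f p.
  by apply/transferred_near; [apply: near_frontier0 | rewrite lift_base].
have [d pu xd] := transferred_walk fu fp; have [d' pv xd'] := transferred_walk fv fp.
by exists d => //; rewrite (transferred_fun xd xd').
Qed.

End ConeTransfer.

(** * The grammar of cones *)

Section ConeGrammar.
Variables (A : finType) (V : choiceType) (edge : V -> letter A -> V -> bool).
Hypotheses (edge_det : deterministic edge) (edge_inv : invertible edge).
Hypothesis edge_conn : forall s t, exists u, walk edge s u t.
Variables (rels : seq (word A * word A)) (x0 xf : V) (w : word A).
Hypothesis x0w : walk edge x0 w xf.
Hypothesis edge_rels : respects edge rels.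
Hypothesis edge_univ : universal edge rels x0 w.
Local Notation walk := (walk edge).
Local Notation near := (near edge).
Local Notation h := (height edge_conn x0w).
Local Notation same_cone := (same_cone edge_conn x0w).
Variable D : nat.
Hypothesis frontier_near : forall x y, h x = h y -> same_cone (h x) x y -> near D x y.

Definition relator_bound :=
  \max_(uv <- rels) maxn (size uv.1 : nat) (size uv.2 : nat).
Local Notation l := relator_bound.
Local Notation r := (radius D l).

Lemma relator_boundP u v : (u, v) \in rels -> size u <= l /\ size v <= l.
Proof.
move=> uv; apply/andP; rewrite -geq_max.
exact: (@leq_bigmax_seq _ _ xpredT (fun x : word A * word A => maxn (size x.1) (size x.2)) (u, v)).
Qed.

Definition cone n c : pred V := fun x => `[< same_cone n c x >].
Definition frontier n c x := cone n c x /\ h x = n.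
Definition nbhd n c := cone_nbhd edge (cone n c) (frontier n c) D l.

Lemma frontier_self c : frontier (h c) c c.
Proof. by split=> //; apply/asboolP/same_cone_refl. Qed.

Lemma cone_height n c x : n <= h c -> cone n c x -> n <= h x.
Proof.
by move=> nc /asboolP[u cx]; apply: (@walk_in_end _ _ edge (fun z => n <= h z)) cx.
Qed.

Lemma cone_step n c x a y : n <= h c -> cone n c x -> edge x a y -> n <= h y -> cone n c y.
Proof.
move=> nc Cx xy ny; have nx := cone_height nc Cx; move: Cx => /asboolP cx.
by apply/asboolP; apply: same_cone_trans cx _; apply: same_cone_edge xy.
Qed.

Lemma cone_cut n c x a y : n <= h c -> edge x a y -> cone n c x -> ~~ cone n c y ->
  frontier n c x.
Proof.
move=> nc xy Cx Cy; split=> //; have nx := cone_height nc Cx.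
have hy : ~ n <= h y by move=> /(cone_step nc Cx xy) Cy'; rewrite Cy' in Cy.
by have := height_edge edge_conn x0w (edge_inv xy); lia.
Qed.

Lemma cone_frontier_near n c x y : frontier n c x -> frontier n c y -> near D x y.
Proof.
move=> [/asboolP cx hx] [/asboolP cy hy]; apply: frontier_near; rewrite hx ?hy //.
exact: same_cone_trans (same_cone_sym edge_inv cx) cy.
Qed.

Lemma low_walk n x : h x < n -> exists z, walk_in edge (fun y => h y < n) x0 z x.
Proof.
have [m hx] := ubnP (h x); elim: m x hx => // m IHm x hx xn.
case: (posnP (h x)) => [/height0[u [v [wE x0x _]]]|/height_pred[a [y [yx hE]]]].
  exists u; apply: walk_edge_in x0x _ => u1 u2 y uE x0y.
  have -> : h y = 0; last by apply: leq_trans xn.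
  by apply/height0; apply: (base_walk edge_det x0w (w2 := u2 ++ v)) x0y; rewrite catA -uE.
have [||z x0y] := IHm y; [by lia..|].
by exists (rcons z a); apply: walk_rcons x0y _; apply/edge_inP; split=> //; lia.
Qed.

(** At level 0 the cone is the whole graph and [w] has height 0. At a positive level [c] has a lower
    neighbour, which is reached from [x0] below level [n]. *)
Lemma cone_start n c : h c = n ->
  frontier n c x0 /\ walk_in edge (frontier n c) x0 w xf \/
  walk_in edge (fun x => ~~ cone n c x) x0 w xf /\ exists z x a y,
  [/\ walk_in edge (fun x => ~~ cone n c x) x0 z x, ~~ cone n c x, edge x a y
    & frontier n c y].
Proof.
move=> hc; have base0 u v x : w = u ++ v -> walk x0 u x -> h x = 0.
  by move=> wE x0x; apply/height0; apply: base_walk wE x0x.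
have out x : h x < n -> ~~ cone n c x.
  by move=> hx; apply/negP => /cone_height; rewrite hc leqnn => /(_ isT); lia.
case: (posnP n) => n0; [left|right].
  have all_c x : cone n c x.
    have [u cx] := edge_conn c x; apply/asboolP; exists u.
    by apply: walk_edge_in cx _; rewrite n0.
  have x0F : frontier n c x0 by split; rewrite // n0 (base0 [::] w).
  split=> //; apply: walk_edge_in x0w _ => u v x wE x0x.
  by split; rewrite // n0 (base0 u v).
split.
  by apply: walk_edge_in x0w _ => u v x wE x0x; apply: out; rewrite (base0 u v).
have [|a [x [xc hE]]] := @height_pred _ _ _ edge_conn _ _ _ x0w c; first by rewrite hc.
have [|z x0x] := @low_walk n x; first by lia.
exists z, x, a, c; split=> //; last by rewrite -hc; apply: frontier_self.
  by apply: walk_subset x0x.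
by apply: out; lia.
Qed.

Lemma nbhd_walk n c x u y : n <= h c -> cone n c x -> walk x u y -> size u <= r -> nbhd n c y.
Proof.
move=> nc; elim: u x => [|a u IHu] x Cx /= => [<- _|[z xz zy] ur]; first by left.
case Cz: (cone n c z); first by apply: IHu zy (ltnW ur).
right; exists x; first by apply: (cone_cut nc xz Cx); rewrite Cz.
by exists (a :: u) => //; exists z.
Qed.

(** The child cone lies in the parent cone. A walk of length at most [r] from it can leave the
    parent cone only through the parent's frontier. *)
Lemma nbhd_sub n c c' x : n <= h c -> cone n c c' -> h c' = n.+1 ->
  nbhd n.+1 c' x -> nbhd n c x.
Proof.
move=> nc /asboolP Cc' hc'.
have sub y : cone n.+1 c' y -> cone n c y.
  by move=> /asboolP/(same_cone_leq (leqnSn n)) c'y; apply/asboolP; apply: same_cone_trans c'y.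
case=> [/sub Cx|[y [/sub Cy _] [u ur yx]]]; first by left.
exact: nbhd_walk nc Cy yx ur.
Qed.

Lemma cone_walk_nbhd n c x u y : frontier n c x ->
  walk_in edge (fun z => n <= h z) x u y -> walk_in edge (nbhd n c) x u y.
Proof.
move=> [/asboolP cx _] xu; apply: walk_edge_in (walk_sub xu) _ => u1 u2 z uE xz.
left; apply/asboolP; apply: same_cone_trans cx _; exists u1.
by move: xu; rewrite uE => /walk_cat[z' xz' _]; rewrite (walk_det edge_det xz (walk_sub xz')).
Qed.

Lemma frontier_link n c x y : frontier n c x -> frontier n c y ->
  exists2 u, size u <= D & walk_in edge (nbhd n c) x u y.
Proof.
move=> Fx Fy; have [u uD xy] := cone_frontier_near Fx Fy; exists u => //.
apply: (@walk_subset _ _ _ (near_frontier edge (frontier n c) r)); first by right.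
apply: (near_walk_in (near_frontier0 edge 0 Fx) _ xy).
by apply: leq_trans uD _; rewrite /radius; lia.
Qed.

(** Exceeds [D + r], as [cone_transfer] requires, and admits [w] as the word of the start symbol. *)
Definition word_bound := D + r + size w + 1.
Local Notation rho := word_bound.
Definition short_word : finType := rho.-bseq (letter A).
Definition cone_nt : finType := ({set short_word * short_word} * short_word)%type.

Lemma word_bound_gt : D + r < rho. Proof. by rewrite /rho; lia. Qed.
Lemma word_boundD (u : word A) : size u <= D -> size u <= rho.
Proof. by move=> uD; apply: leq_trans uD _; rewrite /rho -!addnA leq_addr. Qed.
Lemma word_bound_w : size w <= rho.
Proof. by rewrite /rho; lia. Qed.

(* The nonterminal [(cone_type n c x, u)] stands for the walks in the cone of [c]
   at level [n] from [x] to the end of the walk [u]. *)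
Definition cone_type n c x : {set short_word * short_word} :=
  [set uv | `[< exists2 y, walk_in edge (nbhd n c) x (val uv.1) y
                         & walk_in edge (nbhd n c) x (val uv.2) y >]].

Definition sat p (T : {set short_word * short_word}) := forall uv, uv \in T ->
  exists2 y, walk p (val uv.1) y & walk p (val uv.2) y.

Lemma sat_cone_type n c x : sat x (cone_type n c x).
Proof.
move=> uv; rewrite inE => /asboolP[y /walk_sub xu /walk_sub xv].
by exists y.
Qed.

Lemma transfer n c x p u v y : h c = n -> frontier n c x -> sat p (cone_type n c x) ->
  walk_in edge (nbhd n c) x u y -> walk_in edge (nbhd n c) x v y ->
  exists2 q, walk p u q & walk p v q.
Proof.
move=> hc Fx satp; have nc : n <= h c by rewrite hc.
apply: (@cone_transfer _ _ _ edge_det edge_inv rels x0 xf w edge_rels edge_univ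
  (cone n c) (frontier n c) D l rho relator_boundP word_bound_gt) => //.
- by move=> ? ? ? xy; apply: (cone_cut nc xy).
- exact: cone_frontier_near.
- exact: cone_start.
- move=> u' v' z u'r v'r xu' xv'.
  have [|q pu pv] := satp (Bseq u'r, Bseq v'r); last by exists q.
  by rewrite inE; apply/asboolP; exists z.
Qed.

(** Prefix [v] to the pairs of the type at [x'] and transfer them from [x], which puts no bound on
    their length; determinism then cancels [v]. *)
Lemma sat_transfer n c x p v n' c' x' p' : h c = n -> frontier n c x ->
  sat p (cone_type n c x) -> walk_in edge (nbhd n c) x v x' ->
  (forall z, nbhd n' c' z -> nbhd n c z) -> walk p v p' -> sat p' (cone_type n' c' x').
Proof.
move=> hc Fx satp xx' sub pp' [u1 u2]; rewrite inE => /asboolP[y /= x'u1 x'u2].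
have xu u : walk_in edge (nbhd n' c') x' u y -> walk_in edge (nbhd n c) x (v ++ u) y.
  by move=> /(walk_subset sub); apply: walk_catI.
have [q /walk_cat[p1 pp1 p1q] /walk_cat[p2 pp2 p2q]] :=
  transfer hc Fx satp (xu _ x'u1) (xu _ x'u2).
by exists q; rewrite (walk_det edge_det pp' pp1) //= (walk_det edge_det pp1 pp2).
Qed.

Local Notation symbol := (cone_nt + letter A)%type.

Definition sem p (y : symbol) q := match y with
  | inl X => sat p X.1 /\ walk p (val X.2) q
  | inr a => edge p a q
  end.

Fixpoint run p (s : seq symbol) q :=
  if s is y :: s' then exists2 m, sem p y m & run m s' q else p = q.

(* All sound productions with short bodies are taken: then the grammar is correct
   by construction, and completeness asks that the needed ones be sound. *)
Definition sound (X : cone_nt) (b : seq symbol) := forall p, sat p X.1 ->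
  exists2 q, walk p (val X.2) q & run p b q.

(** A walk that climbs needs four symbols: the step up, the child cone, the step down and the
    rest. *)
Definition cone_cfg : cfg (letter A) := @CFG (letter A) cone_nt
  (cone_type 0 x0 x0, Bseq word_bound_w)
  [seq (x.1, val x.2) | x <- enum (fun x : cone_nt * 4.-bseq symbol => `[< sound x.1 (val x.2) >])].

Lemma cone_productionP X b : (X, b) \in productions cone_cfg -> sound X b.
Proof. by case/mapP=> x; rewrite mem_enum => /asboolP xb [-> ->]. Qed.

Lemma cone_production X (b : seq symbol) : size b <= 4 -> sound X b ->
  (X, b) \in productions cone_cfg.
Proof.
move=> b4 Xb; apply/mapP; exists (X, Bseq b4) => //.
by rewrite mem_enum; apply/asboolP.
Qed.

(** A sound body ends where the word of its nonterminal does, so by determinism expanding a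
    nonterminal keeps the end of the run. *)
Lemma yields_run (s : seq (nonterminal cone_cfg + letter A)) u p q :
  yields s u -> run p s q -> walk p u q.
Proof.
move=> su; elim: su p q => {s u} [|a s u _ IH|X b s u v Xb _ IHb _ IHs] p q //=.
  by case=> m pm /IH mq; exists m.
case=> m [satp pm] /IHs mq; apply: walk_catI mq; apply: IHb.
by have [m' pm' pbm'] := cone_productionP Xb satp; rewrite (walk_det edge_det pm pm').
Qed.

Lemma first_return n x z y : n < h x -> h y = n ->
  walk_in edge (fun v => n <= h v) x z y -> exists z1 b z2 x1 x2,
  [/\ z = z1 ++ b :: z2, walk_in edge (fun v => n < h v) x z1 x1, edge x1 b x2,
      h x1 = n.+1 /\ h x2 = n & walk_in edge (fun v => n <= h v) x2 z2 y].
Proof.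
elim: z x => [|a z IHz] x hx hy /=; first by move=> xy; rewrite xy in hx; lia.
case=> m /edge_inP[xm nx nm] my; case: (ltnP n (h m)) => hm.
  have [z1 [b [z2 [x1 [x2 [-> mx1 x12 hx12 x2y]]]]]] := IHz m hm hy my.
  exists (a :: z1), b, z2, x1, x2; split=> //; exists m => //.
  exact/edge_inP.
exists [::], a, z, x, m; split=> //; have := height_edge edge_conn x0w (edge_inv xm).
by lia.
Qed.

(** Induction on the length of [z]. Its first step stays on the frontier, or enters a child cone
    that [z] leaves at its first return to level [n]. The production is sound because [u] and the
    short walk describing its body are coterminal, hence transfer to every [p] of the same type. *)
Lemma yields_cone k n c x y z (u : short_word) : size z < k -> h c = n ->
  frontier n c x -> frontier n c y -> walk_in edge (nbhd n c) x (val u) y ->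
  walk_in edge (fun v => n <= h v) x z y ->
  yields (G := cone_cfg) [:: inl (cone_type n c x, u)] z.
Proof.
elim: k n c x y z u => // k IHk n c x y z u zk hc Fx Fy xuy xzy.
have nc : n <= h c by rewrite hc.
suff [b [b4 sb bz]] : exists b, [/\ size b <= 4, sound (cone_type n c x, u) b
    & yields (G := cone_cfg) b z].
  rewrite -(cats0 z); apply: (yields_rule (cone_production b4 sb) bz).
  exact: yields_nil.
case: z zk xzy => [|a z] zk /=.
  move=> xy; rewrite -{}xy in xuy Fy; exists [::]; split=> // [p satp|].
    by have [q pu /= pq] := transfer hc Fx satp xuy (erefl : walk_in edge _ x [::] x); exists q.
  exact: yields_nil.
case=> x1 /edge_inP[xx1 nx nx1] x1y; have Cx1 : cone n c x1 by apply: cone_step nc Fx.1 xx1 nx1.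
have Nxx1 : walk_in edge (nbhd n c) x [:: a] x1.
  by apply: cone_walk_nbhd Fx _; apply/walk1/edge_inP.
have [hx1|hx1] : h x1 = n \/ h x1 = n.+1.
  by have := height_edge edge_conn x0w xx1; rewrite Fx.2; lia.
  have Fx1 : frontier n c x1 by [].
  have [u1 u1D x1u1] := frontier_link Fx1 Fy.
  exists [:: inr a; inl (cone_type n c x1, Bseq (word_boundD u1D))]; split=> // [p satp|].
    have [q pu /walk_cat[p1 pp1 p1q]] := transfer hc Fx satp xuy (walk_catI Nxx1 x1u1).
    exists q => //; exists p1; first exact/walk1.
    by exists q => //; split=> //; apply: sat_transfer hc Fx satp Nxx1 _ pp1.
  by apply: yields_letter; apply: (IHk _ _ _ y).
have [z1 [b [z2 [x2 [x3 [zE x1x2 x23 [hx2 hx3] x3y]]]]]] :=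
  @first_return n x1 z y (eq_leq (esym hx1)) Fy.2 x1y.
have Fx1 : frontier n.+1 x1 x1 by rewrite -hx1; apply: frontier_self.
have Fx2 : frontier n.+1 x1 x2 by split=> //; apply/asboolP; exists z1.
have sub v : nbhd n.+1 x1 v -> nbhd n c v by apply: nbhd_sub.
have Cx2 : cone n c x2.
  by apply/asboolP; apply: same_cone_trans (asboolW Cx1) _; apply: same_cone_leq (asboolW Fx2.1).
have Fx3 : frontier n c x3 by split=> //; apply: cone_step nc Cx2 x23 _; rewrite hx3.
have [u1 u1D x1u1] := frontier_link Fx1 Fx2; have [u3 u3D x3u3] := frontier_link Fx3 Fy.
have Nx1x2 := walk_subset sub x1u1.
have Nx2x3 : walk_in edge (nbhd n c) x2 [:: b] x3.
  by apply/walk1/edge_inP; split=> //; left=> //; apply: Fx3.1.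
have Nxx3 := walk_catI Nxx1 (walk_catI Nx1x2 Nx2x3).
exists [:: inr a; inl (cone_type n.+1 x1 x1, Bseq (word_boundD u1D)); inr b;
           inl (cone_type n c x3, Bseq (word_boundD u3D))]; split=> // [p satp|].
  have [q pu /walk_cat[p3 pp3 p3q]] := transfer hc Fx satp xuy (walk_catI Nxx3 x3u3).
  have := pp3 => /walk_cat[p1 pp1 /walk_cat[p2 p12 p23]].
  exists q => //; exists p1; first exact/walk1.
  exists p2; first by split=> //; apply: sat_transfer hc Fx satp Nxx1 sub pp1.
  exists p3; first exact/walk1.
  by exists q => //; split=> //; apply: sat_transfer hc Fx satp Nxx3 _ pp3.
move: zk; rewrite zE /= size_cat /= => zk; apply: yields_letter.
apply/(yields_cat [:: inl _]); exists z1, (b :: z2); split=> //.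
  by apply: (IHk _ _ _ x2) => //; simpl in *; lia.
by apply: yields_letter; apply: (IHk _ _ _ y) => //; simpl in *; lia.
Qed.

Lemma frontier_context_free : context_free (accepted edge x0 xf).
Proof.
have h0 x : base edge x0 xf w x -> h x = 0 by move/(height0 edge_conn x0w).
have x0E := h0 _ (base_x0 x0w); have xfE := h0 _ (base_xf x0w).
have nb x u y : walk x u y -> walk_in edge (fun v => 0 <= h v) x u y by move/walk_edge_in; apply.
have Fx0 : frontier 0 x0 x0 by rewrite -x0E; apply: frontier_self.
have Fxf : frontier 0 x0 xf by split=> //; apply/asboolP; exists w; apply: nb.
exists cone_cfg; apply/seteqP; split=> z.
  move=> /derives_yields/yields_run; apply; exists xf => //.
  by split; [apply: sat_cone_type | ].
move=> x0z; apply/derives_yields.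
apply: (@yields_cone (size z).+1 0 x0 x0 xf z (Bseq word_bound_w)) => //; last exact: nb.
by apply: cone_walk_nbhd Fx0 _; apply: nb.
Qed.

End ConeGrammar.

(** * The Schützenberger graph and the equivalence *)

Section SchutzenbergerGraph.
Variables (A : finType) (rels : seq (word A * word A)) (w : word A).
Local Notation edge := (@sch_edge A rels w).
Local Notation x0 := (sch_init rels w).

Lemma sch_edge_det : deterministic edge.
Proof. by move=> s a t t' /eqP tE /eqP t'E; apply: sch_elt_inj; rewrite tE. Qed.

Lemma sch_respects : respects edge rels.
Proof.
move=> u v uv s t; have E : InvElt rels u = InvElt rels v by apply/InvEltP/ic_rel.
by split=> /sch_walkP st; apply/sch_walkP; rewrite st E.
Qed.

Lemma sch_walk_w : walk edge x0 w (sch_final rels w).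
Proof.
apply/sch_walkP; rewrite /sch_elt /=.
by rewrite InvEltM InvElt_reg.
Qed.

(** Coterminal walks [u] and [v] from [x0] give equal elements [w w^-1 u] and [w w^-1 v], and [E]
    has a loop [w w^-1] at [s]; by [inv_cong_walk] the two words act alike at [s]. *)
Lemma sch_universal : universal edge rels x0 w.
Proof.
move=> Q E E_det E_inv E_rels s t st u v x x0u x0v.
have ww : walk E s (w ++ winv w) s by apply: (walk_catI st); apply: walk_inv.
have E_walk y z x' : walk edge x0 y x' -> walk edge x0 z x' -> forall q,
    walk E s y q -> walk E s z q.
  move=> /sch_walkP + /sch_walkP; rewrite /sch_elt /= => -> + q sq.
  rewrite -!InvEltM => /InvEltP/(inv_cong_walk E_det E_inv E_rels)/(_ s q)[+ _].
  case/(_ (walk_catI ww sq))/walk_cat=> s' /(walk_det E_det ww) <-.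
  exact.
(* To see that [u] can be read at [s] at all, complete it to a loop at [x0] and compare with the
   empty walk. *)
have [y xx0] := sch_connected x x0.
have x0loop := walk_catI x0u xx0.
have /walk_cat[q su _] : walk E s (u ++ y) s.
  exact: (E_walk [::] (u ++ y) x0).
by exists q => //; apply: E_walk x0v q su.
Qed.

End SchutzenbergerGraph.

Theorem theorem1 (R : realType) (A : finType) (rels : seq (word A * word A))
    (w : word A) :
  tree_like R (adj (@sch_edge A rels w)) <-> context_free (sch_language rels w).
Proof.
have det := @sch_edge_det A rels w; have inv := @sch_edge_inv A rels w.
have conn := @sch_connected A rels w; have x0w := sch_walk_w rels w.
split=> [tree|[G langG]].
  have [k thin] := tree_like_thin conn (sch_init rels w) tree.
  have [D frontier_D] := thin_frontier det inv conn x0w thin.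
  exact: frontier_context_free (@sch_respects A rels w) (@sch_universal A rels w) _ frontier_D.
have [k thin] := context_free_thin det inv langG x0w.
have [D frontier_D] := thin_frontier det inv conn x0w thin.
exact: frontier_tree_like frontier_D R.
Qed.
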